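(* Let $V$ be an $\mathbb{F}_q$-vector space of finite dimension $r\ge1$ and let $G:=\operatorname{Aut}_{\mathbb{F}_q}(V)\cong\operatorname{GL}_r(\mathbb{F}_q)$. For any unipotent subgroup $H\subset G$ and any integer $n\ge0$ we have $$\dim R^H_{V,-n}\ =\ \sum_{s=1}^r\ \frac{|H\backslash G/L_s|}{[P_s:UL_s]}\cdot\binom{n-1}{s-1}.$$
   Context: $\mathbb{F}_q$ is a finite field with $q$ elements. $S_V$ is the symmetric algebra of $V$ over $\mathbb{F}_q$, $K_V$ its field of quotients, and $R_V\subset K_V$ the $\mathbb{F}_q$-subalgebra generated by $\frac1v$ for all $v\in V\setminus\{0\}$, graded such that each $\frac1v$ has degree $-1$; $G$ acts on $R_V$ by functoriality, and $R^H_{V,-n}$ is the space of $H$-invariants in the homogeneous part of degree $-n$. A unipotent subgroup of $G$ is equivalently a $p$-subgroup, where $p$ is the characteristic of $\mathbb{F}_q$. Let $U$ be a maximal unipotent subgroup of $G$, and choose a basis of $V$ such that $U$ corresponds to the group of upper triangular matrices with all diagonal entries equal to $1$. For $1\le s\le r$ let $P_s\subset G$ be the subgroup corresponding to the matrices of block triangular form $\begin{pmatrix} *&*\\0&*\end{pmatrix}$ with upper left block of size $s\times s$ and lower right block of size $(r-s)\times(r-s)$ (so $P_r=G$), and let $L_s$ be the normal subgroup of $P_s$ corresponding to the matrices of the form $\begin{pmatrix}1_s&*\\0&*\end{pmatrix}$, where $1_s$ is the identity matrix of size $s\times s$. One has $[P_s:UL_s]=\prod_{i=1}^s(q^i-1)$.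 $H\backslash G/L_s$ is the set of double cosets. Binomial coefficients are $\binom{x}{k}=\frac{x(x-1)\cdots(x-k+1)}{k!}$, also for negative $x$. *)

(* Defs.v *)
From HB Require Import structures.
From mathcomp Require Import all_boot all_order all_algebra all_fingroup.
From mathcomp Require Import all_field generic_quotient fraction.
From mathcomp Require Export mpoly.

Set Implicit Arguments.
Unset Strict Implicit.
Unset Printing Implicit Defensive.

Import GRing.Theory.
Local Open Scope ring_scope.

(* [S_V], as the polynomial ring in the vectors of the fixed basis
   [vbasis {:V}] of [V].  It is independent of the flag basis [e] used further
   down to describe subgroups of [Aut V]. *)
Notation symAlg F V := {mpoly F[\dim (@fullv F V)]}.

Definition symInj (F : fieldType) (V : vectType F) (v : V) :
    symAlg F V :=
  \sum_(i < \dim {:V}) coord (vbasis {:V}) i v *: 'X_i.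

(* The algebra endomorphism of [S_V] induced by [g : V -> V]. *)
Definition symMap (F : fieldType) (V : vectType F) (g : V -> V)
    (p : symAlg F V) : symAlg F V :=
  comp_mpoly [tuple symInj (g (vbasis {:V})`_i) | i < \dim {:V}] p.

Definition symFrac (F : fieldType) (V : vectType F) :=
  {fraction symAlg F V}.
HB.instance Definition _ (F : fieldType) (V : vectType F) :=
  GRing.Field.on (symFrac V).

Section FracModule.
Variables (F : fieldType) (V : vectType F).

Definition toFrac (p : symAlg F V) : symFrac V := FracField.tofrac p.
Definition scaleFrac (c : F) (x : symFrac V) : symFrac V :=
  toFrac c%:MP * x.

Fact scaleFracA a b x : scaleFrac a (scaleFrac b x) = scaleFrac (a * b) x.
Proof. by rewrite /scaleFrac mulrA /toFrac -tofracM -mpolyCM. Qed.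
Fact scaleFrac1 : left_id 1 scaleFrac.
Proof. by move=> x; rewrite /scaleFrac /toFrac mpolyC1 tofrac1 mul1r. Qed.
Fact scaleFracDr : right_distributive scaleFrac +%R.
Proof. by move=> c x y; rewrite /scaleFrac mulrDr. Qed.
Fact scaleFracDl x : {morph scaleFrac^~ x : a b / a + b}.
Proof.
by move=> a b; rewrite /scaleFrac /toFrac mpolyCD tofracD mulrDl.
Qed.
HB.instance Definition _ := GRing.Zmodule_isLmodule.Build F (symFrac V)
  scaleFracA scaleFrac1 scaleFracDr scaleFracDl.

End FracModule.

(* The action on [K_V] computed on a chosen representative numerator and
   denominator; by [fracMap_div] below, the choice is irrelevant when [g] is
   a linear automorphism. *)
Definition fracMap (F : fieldType) (V : vectType F) (g : V -> V)
    (x : symFrac V) : symFrac V :=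
  toFrac (symMap g \n_(repr x)) / toFrac (symMap g \d_(repr x)).

(* [R_{V,-n}]: the generators [1/v] have degree [-1], so the part of degree
   [-n] is the [F]-span of the products of [n] generators. *)
Definition RVdeg (F : fieldType) (V : vectType F) (n : nat)
    (x : symFrac V) : Prop :=
  exists (m : nat) (c : 'I_m -> F) (v : 'I_m -> 'I_n -> V),
    (forall i j, v i j != 0) /\
    x = \sum_(i < m) c i *: \prod_(j < n) (toFrac (symInj (v i j)))^-1.

(* [W] is a subspace of dimension [d] ([K_V] is not finite dimensional over
   [F], so the theory of [{vspace _}] is not available). *)
Definition hasDim (F : fieldType) (E : lmodType F) (W : E -> Prop) (d : nat) :
    Prop :=
  exists b : 'I_d -> E,
    (forall x, W x <-> exists c : 'I_d -> F, x = \sum_(i < d) c i *: b i) /\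
    (forall c : 'I_d -> F, \sum_(i < d) c i *: b i = 0 -> forall i, c i = 0).

Section Groups.
Variables (F : finFieldType) (V : vectType F).
Local Notation fV := (finvect_type V).

(* Pitfall: permutations compose as [(g * h) v = h (g v)], so that a product
   here is the reverse of the product of [Aut V]. *)
Definition autV : {set {perm fV}} :=
  [set g : {perm fV} |
    [forall a : F, forall u : fV, forall v : fV,
       g (a *: u + v) == a *: g u + g v]].

Lemma autVP (g : {perm fV}) :
  reflect (forall (a : F) (u v : fV), g (a *: u + v) = a *: g u + g v)
          (g \in autV).
Proof.
rewrite inE; apply: (iffP forallP) => [h a u v|h a].
  by move/(_ a)/forallP/(_ u)/forallP/(_ v)/eqP: h.
by apply/forallP => u; apply/forallP => v; rewrite h.
Qed.

Lemma autV_group_set : group_set autV.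
Proof.
apply/group_setP; split; first by apply/autVP => a u v; rewrite !perm1.
move=> g h /autVP lg /autVP lh; apply/autVP => a u v.
by rewrite !permM lg lh.
Qed.
Canonical autV_group := Group autV_group_set.

Definition unipotent (H : {group {perm fV}}) : Prop :=
  H \subset autV /\
  forall h : {perm fV}, h \in H ->
    exists N : nat, forall v : fV, iter N (fun x => h x - x) v = 0.

Definition max_unipotent (U : {group {perm fV}}) : Prop :=
  unipotent U /\
  forall U' : {group {perm fV}}, unipotent U' -> U \subset U' -> U' = U.

(* Matrices act on columns of coordinates: column [j] of [matOf e g] holds the
   coordinates of [g e_j]. *)
Definition matOf (r : nat) (e : r.-tuple V) (g : {perm fV}) : 'M[F]_r :=
  \matrix_(i < r, j < r) coord e i (g e`_j).

Definition unitriangular (r : nat) (e : r.-tuple V) : {set {perm fV}} :=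
  [set g in autV | [forall i : 'I_r, forall j : 'I_r,
     (j <= i)%N ==> (matOf e g i j == (i == j)%:R)]].

Definition parabolic (r : nat) (e : r.-tuple V) (s : nat) : {set {perm fV}} :=
  [set g in autV | [forall i : 'I_r, forall j : 'I_r,
     (j < s <= i)%N ==> (matOf e g i j == 0)]].

Definition parabolicL (r : nat) (e : r.-tuple V) (s : nat) :
    {set {perm fV}} :=
  [set g in autV | [forall i : 'I_r, forall j : 'I_r,
     (j < s)%N ==> (matOf e g i j == (i == j)%:R)]].

(* [H \ G / L]; the factors are reversed because of the reversed product. *)
Definition doubleCosets (H G L : {set {perm fV}}) : {set {set {perm fV}}} :=
  [set (L * [set g] * H)%g | g in G].

Definition invRV (H : {set {perm fV}}) (n : nat) (x : symFrac V) : Prop :=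
  RVdeg n x /\ forall h : {perm fV}, h \in H -> fracMap (h : V -> V) x = x.

End Groups.

Definition binz (x : int) (k : nat) : rat :=
  (\prod_(i < k) (x - i%:Z))%:~R / (k`!)%:R.

Section ActionWellDefined.
Variables (F : fieldType) (V : vectType F).
Implicit Types (g h : {linear V -> V}) (p q : symAlg F V).

Fact symInj_is_linear : linear (@symInj F V).
Proof.
move=> a u v; rewrite /symInj scaler_sumr -big_split.
by apply: eq_bigr => i _ /=; rewrite linearP /= scalerDl scalerA.
Qed.
HB.instance Definition _ := GRing.isLinear.Build F V (symAlg F V) _
  (@symInj F V) symInj_is_linear.

Lemma symInj_vbasis (i : 'I_(\dim {:V})) : symInj (vbasis {:V})`_i = 'X_i.
Proof.
rewrite /symInj (bigD1 i) //= coord_free ?(basis_free (vbasisP _)) //.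
rewrite eqxx scale1r big1 ?addr0 // => j ji.
rewrite coord_free ?(basis_free (vbasisP _)) //.
by rewrite eq_sym (negPf ji) scale0r.
Qed.

Lemma symMap_symInj g (v : V) : symMap g (symInj v) = symInj (g v).
Proof.
rewrite {2}(coord_vbasis (memvf v)) !linear_sum.
rewrite /symMap {1}/symInj linear_sum /=.
apply: eq_bigr => i _; rewrite !linearZ /= comp_mpolyXU.
by rewrite nth_mktuple.
Qed.

Lemma symMapM g : {morph symMap g : p q / p * q}.
Proof. by move=> p q; rewrite /symMap rmorphM. Qed.

Lemma symMap_comp g h p : symMap g (symMap h p) = symMap (g \o h) p.
Proof.
rewrite {2 3}/symMap !comp_mpolyEX /symMap linear_sum /=.
apply: eq_bigr => m _; rewrite linearZ /= !comp_mpolyX rmorph_prod /=.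
congr (_ *: _); apply: eq_bigr => i _; rewrite rmorphXn /= !tnth_mktuple /=.
by congr (_ ^+ _); exact: symMap_symInj.
Qed.

Lemma symMap_id p : symMap (idfun : V -> V) p = p.
Proof.
rewrite /symMap -[RHS]comp_mpoly_id; congr comp_mpoly.
by apply: eq_from_tnth => i; rewrite !tnth_mktuple symInj_vbasis.
Qed.

Lemma symMap_eq0 g h p : cancel g h -> (symMap g p == 0) = (p == 0).
Proof.
move=> gK; apply/eqP/eqP => [gp0|->]; last by rewrite /symMap linear0.
have <- : symMap (h \o g) p = p.
  rewrite -[RHS]symMap_id; congr comp_mpoly.
  by apply: eq_from_tnth => i; rewrite !tnth_mktuple /= gK.
by rewrite -symMap_comp gp0 /symMap linear0.
Qed.

Lemma fracE (x : symFrac V) : x * toFrac \d_(repr x) = toFrac \n_(repr x).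
Proof.
rewrite -{1}[x]reprK /toFrac; unlock FracField.tofrac.
rewrite -[LHS]FracField.pi_mul; apply/eqmodP => /=.
rewrite /FracField.mulf FracField.equivfE.
by rewrite !numden_Ratio ?mulf_neq0 ?denom_ratioP ?oner_neq0 // !mulr1 mulrC.
Qed.

Lemma fracMap_div g h p q :
  cancel g h -> q != 0 ->
  fracMap g (toFrac p / toFrac q) = toFrac (symMap g p) / toFrac (symMap g q).
Proof.
move=> gK q0; set x := _ / _.
have toFrac0 (t : symAlg F V) : (toFrac t == 0 :> symFrac V) = (t == 0).
  exact: tofrac_eq0.
have d0 : \d_(repr x) != 0 by exact: denom_ratioP.
have e : \n_(repr x) * q = p * \d_(repr x).
  apply/eqP; rewrite -tofrac_eq !tofracM -/(toFrac _) -fracE.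
  by rewrite mulrAC /x divfK ?toFrac0.
rewrite /fracMap; apply/eqP; rewrite eqr_div ?toFrac0 ?(symMap_eq0 _ gK) //.
by rewrite /toFrac -!tofracM -!symMapM e.
Qed.

End ActionWellDefined.

(* Main.v *)
From HB Require Import structures.
Require Import Defs.
From mathcomp Require Import all_boot all_order all_algebra all_fingroup.
From mathcomp Require Import all_field.
From mathcomp Require Import all_solvable generic_quotient fraction.

Set Implicit Arguments.
Unset Strict Implicit.
Unset Printing Implicit Defensive.
Import GRing.Theory.
Local Open Scope ring_scope.


(** The space of homogeneous elements of degree [-n] has an explicit basis that a
maximal unipotent group permutes, so that its invariants are counted by orbits.

Call [v] monic at [i] if [v - e_i] lies in the span of [e_0, ..., e_(i-1)].  A
standard monomial is a product of powers [c_i ^- m_i], over the indices [i] of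
some subset [J] of the basis, with [c_i] monic at [i] and [m_i > 0].  The standard
monomials with [\sum m_i = n] form a basis of the degree [-n] part.
- They span ([recip_prod_in_span]): if [v] and [w] are monic at the same index, the
  relation [1/(v w) = 1/((v-w) w) - 1/((v-w) v)] replaces one of them by the lower
  vector [v - w], and this process terminates.
- They are independent ([monomial_free]): adjoining one basis vector at a time, as
  an indeterminate over the field generated by the previous ones, the powers
  [(X + w)^-m] are independent by uniqueness of partial fractions.

An element of the unitriangular group [U] maps vectors monic at [i] to vectors
monic at [i]; hence if [H] is contained in [U], it permutes this basis and
[dim R^H] is the number of its orbits ([hasDim_invRV]).  The general case reduces
to this one by Sylow's theorem: unipotent subgroups are the [p]-subgroups, so a
conjugate of [H] lies in the maximal one ([unipotent_conj_sub]), and conjugation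
changes neither side of the formula.

It remains to count.  By the Cauchy-Frobenius lemma it suffices to fix [h] in [H]
and count fixed points.  A choice of vectors [c_i], [i] in [J], is called a
configuration with support [J]; there are [binom (n-1) (#|J|-1)] exponent vectors
for it when [n > 0] and [J] is nonempty.  For [n = 0] there is only the empty
monomial, while [binom (-1) (s-1) = (-1)^(s-1)]; the formula then says that the
alternating sum over all fixed configurations vanishes, and it does since adding
or removing [e_0], the only vector monic at [0], is a sign-reversing involution
([fix_count_identity]).

Finally the number of [H]-orbits of configurations with support of size [s] is
[#|H \ G / L_s| / [P_s : U L_s]] ([orbit_configs_dcosets]).  A coset of [L_s] is an
independent [s]-tuple of vectors; configurations are those tuples that are in
column echelon form.  Gaussian elimination says that every tuple is obtained from
one in echelon form by an element of [P_s], which is unique up to [U L_s].  So [G]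
is a disjoint union of [[P_s : U L_s]] translates of the set of echelon
automorphisms, all with the same number of double cosets ([card_dcosets_split]). *)

(** * Specialization of fractions and partial fractions *)

Notation "x %:F" := (FracField.tofrac x) : ring_scope.

(** The homomorphism [ev] extends to the fractions whose denominator it does not kill.
The extension is described by its graph, since it is only partially defined. *)
Definition specializes (S : idomainType) (L : fieldType) (ev : S -> L)
    (x : {fraction S}) (y : L) : Prop :=
  exists p q, [/\ ev q != 0, x = p%:F / q%:F & y = ev p / ev q].

Section Specialization.
Variables (S : idomainType) (L : fieldType) (ev : {rmorphism S -> L}).
Local Notation spec := (specializes ev).

Lemma ev_neq0 q : ev q != 0 -> q%:F != 0.
Proof. by rewrite tofrac_eq0; apply: contraNneq => ->; rewrite rmorph0. Qed.

Lemma specializes_tofrac p : spec p%:F (ev p).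
Proof. by exists p, 1; rewrite rmorph1 tofrac1 !divr1 oner_eq0. Qed.

Lemma specializesD x y x' y' : spec x y -> spec x' y' -> spec (x + x') (y + y').
Proof.
move=> [p [q [q0 -> ->]]] [p' [q' [q0' -> ->]]].
exists (p * q' + p' * q), (q * q'); rewrite !rmorphM !rmorphD !rmorphM /=.
by rewrite mulf_neq0 // !addf_div // ev_neq0.
Qed.

Lemma specializesM x y x' y' : spec x y -> spec x' y' -> spec (x * x') (y * y').
Proof.
move=> [p [q [q0 -> ->]]] [p' [q' [q0' -> ->]]].
exists (p * p'), (q * q'); rewrite !rmorphM /=.
by rewrite mulf_neq0 // !mulf_div.
Qed.

Lemma specializesV x y : y != 0 -> spec x y -> spec x^-1 y^-1.
Proof.
move=> y0 [p [q [q0 -> e]]]; exists q, p; rewrite e !invf_div; split=> //.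
by apply: contraNneq y0; rewrite e => ->; rewrite mul0r.
Qed.

Lemma specializesX n x y : spec x y -> spec (x ^+ n) (y ^+ n).
Proof.
move=> h; elim: n => [|n IH]; last by rewrite !exprS; apply: specializesM.
by rewrite !expr0 -(rmorph1 ev) -(tofrac1 S); apply: specializes_tofrac.
Qed.

Lemma specializes_sum (I : Type) (s : seq I) (P : pred I) f g :
  (forall i, P i -> spec (f i) (g i)) ->
  spec (\sum_(i <- s | P i) f i) (\sum_(i <- s | P i) g i).
Proof.
move=> h; apply: big_ind2 => //; last exact: specializesD.
by rewrite -(rmorph0 ev) -(tofrac0 S); apply: specializes_tofrac.
Qed.

Lemma specializes_prod (I : Type) (s : seq I) (P : pred I) f g :
  (forall i, P i -> spec (f i) (g i)) ->
  spec (\prod_(i <- s | P i) f i) (\prod_(i <- s | P i) g i).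
Proof.
move=> h; apply: big_ind2 => //; last exact: specializesM.
by rewrite -(rmorph1 ev) -(tofrac1 S); apply: specializes_tofrac.
Qed.

Lemma specializes0 y : spec 0 y -> y = 0.
Proof.
move=> [p [q [q0 e ->]]]; move/esym/eqP: e.
rewrite mulf_eq0 invr_eq0 (negPf (ev_neq0 q0)) orbF tofrac_eq0 => /eqP ->.
by rewrite rmorph0 mul0r.
Qed.
End Specialization.

Section PartialFractions.
Variables (L : fieldType) (J : finType) (P : pred J) (w : J -> L).
Variables (l : J -> nat) (x : J -> L).
Let term j : {fraction {poly L}} :=
  (x j)%:P%:F / ('X + (w j)%:P)%:F ^+ l j.

(** Uniqueness of partial fractions.  Among the terms with nonzero coefficient take one,
[j0], of highest order: multiplying the relation by [('X + w j0) ^+ l j0] and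
specializing ['X] to [- w j0] leaves the coefficient of this term only.  Order [0]
stands for the constant term, for which [w] is irrelevant; hence the form of the
hypothesis that the terms are distinct. *)
Lemma partial_fractions :
  {in P &, forall i j, l i = l j -> (0 < l i -> w i = w j)%N -> i = j} ->
  \sum_(j | P j) term j = 0 -> forall j, P j -> x j = 0.
Proof.
move=> inj sum0 j0 Pj0; apply/eqP/negPn/negP => xj0.
pose Q := [pred j | P j && (x j != 0)].
have Qj0 : Q j0 by rewrite /= Pj0.
case: (arg_maxnP l Qj0) => {Pj0 xj0 Qj0}j0 /andP[Pj0 xj0] lmax.
pose ev : {rmorphism {poly L} -> L} := horner_eval (- w j0).
pose t := ('X + (w j0)%:P)%:F ^+ l j0 : {fraction {poly L}}.
have evX j : ev ('X + (w j)%:P) = w j - w j0.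
  by rewrite /ev /= /horner_eval hornerD hornerX hornerC addrC.
have evC c : ev c%:P = c by rewrite /ev /= /horner_eval hornerC.
have tn0 j : ('X + (w j)%:P)%:F != 0 :> {fraction {poly L}}.
  by rewrite tofrac_eq0 -size_poly_eq0 size_XaddC.
suff H : specializes ev (t * \sum_(j | P j) term j)
             (\sum_(j | P j) (if j == j0 then x j0 else 0)).
  move: H; rewrite sum0 mulr0 => /specializes0; rewrite -big_mkcondr /=.
  rewrite (big_pred1 j0) ?(negPf xj0) // => [/eqP|j /=]; first by rewrite (negPf xj0).
  by case: eqP => [->|]; rewrite ?Pj0 ?andbF.
rewrite mulr_sumr; apply: specializes_sum => j Pj.
have [->|jj0] := eqVneq j j0.
  rewrite /t mulrC divfK ?expf_neq0 //.
  rewrite -{2}(evC (x j0)); exact: specializes_tofrac.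
have [xj|xj] := eqVneq (x j) 0.
  rewrite /term xj polyC0 tofrac0 mul0r mulr0 -(tofrac0 {poly L}).
  by rewrite -(rmorph0 ev); apply: specializes_tofrac.
have lj : (l j <= l j0)%N by apply: lmax; rewrite /= Pj.
have [ww|ww] := eqVneq (w j) (w j0).
  have lt : (l j < l j0)%N.
    rewrite ltn_neqAle lj andbT; apply: contraNneq jj0 => ll.
    by apply/eqP/inj.
  rewrite /term ww mulrCA /t -(subnK lj) exprD mulfK ?expf_neq0 //.
  rewrite -tofracXn -tofracM.
  have -> : 0 = ev ((x j)%:P * ('X + (w j0)%:P) ^+ (l j0 - l j)).
    by rewrite rmorphM rmorphXn /= evX subrr expr0n subn_eq0 leqNgt lt mulr0.
  exact: specializes_tofrac.
have l0 : (0 < l j0)%N.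
  rewrite lt0n; apply: contraNneq jj0 => l0; apply/eqP/inj => //; last first.
    by move: lj; rewrite l0 leqn0 => /eqP ->.
  by move: lj; rewrite l0 leqn0 => /eqP.
have -> : 0 = ev ('X + (w j0)%:P) ^+ l j0 *
                 (ev (x j)%:P / ev ('X + (w j)%:P) ^+ l j).
  by rewrite evX subrr expr0n -leqn0 leqNgt l0 mul0r.
apply: specializesM; first by apply: specializesX; apply: specializes_tofrac.
apply: specializesM; first exact: specializes_tofrac.
apply: specializesV; first by rewrite expf_neq0 // evX subr_eq0.
by apply: specializesX; apply: specializes_tofrac.
Qed.
End PartialFractions.

(** * The flag of a basis *)

Section Flag.
Variables (F : fieldType) (V : vectType F) (r : nat) (e : r.-tuple V).
Implicit Types (i j : 'I_r) (k : nat) (v w : V).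

Definition flag k : {vspace V} := <<take k e>>%VS.
(** That is, the last nonzero coordinate of [v] is the [i]-th one and is equal to [1]
([monicE]); this form shows at once that unitriangular maps preserve the property. *)
Definition monic_at i v := v - e`_i \in flag i.
(** One more than the index of the leading coordinate, and [0] for the zero vector: the
least [k] such that [v] is in [flag k]. *)
Definition level v := \max_(i < r | coord e i v != 0) i.+1.

Hypothesis basis_e : basis_of {:V} e.

Lemma coord_sumE v : v = \sum_i coord e i v *: e`_i.
Proof. exact: coord_basis basis_e (memvf v). Qed.

Lemma coord_e i j : coord e i e`_j = (i == j)%:R.
Proof. by rewrite coord_free ?(basis_free basis_e) // eq_sym. Qed.

Lemma level_le k v : (level v <= k)%N = (v \in flag k).
Proof.
apply/bigmax_leqP/idP => [h|vk i].
  rewrite [v]coord_sumE; apply: memv_suml => i _.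
  have [->|/h ik] := eqVneq (coord e i v) 0; first by rewrite scale0r mem0v.
  apply/memvZ/memv_span; rewrite -(nth_take 0 ik) mem_nth // size_take.
  by rewrite size_tuple; case: ifP.
rewrite ltnNge; apply: contraNN => ki.
move: vk => /(@coord_span _ _ _ (in_tuple (take k e))) ->.
rewrite linear_sum big1 //= => -[j /= jk] _; rewrite linearZ /=.
have jk' : (j < k)%N by apply: leq_trans jk _; rewrite size_take_min geq_minl.
have jr : (j < r)%N by apply: leq_trans (ltn_ord i); apply: ltn_trans jk' _.
rewrite nth_take // (coord_e i (Ordinal jr)) -val_eqE /= gtn_eqF ?scaler0 //.
  by rewrite mulr0.
by apply: leq_trans ki.
Qed.

Lemma mem_flagP k v :
  reflect (forall i, (k <= i)%N -> coord e i v = 0) (v \in flag k).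
Proof.
rewrite -level_le; apply: (iffP (bigmax_leqP _ _ _)) => [h i|h i]; last first.
  by rewrite ltnNge; apply: contraNN => /h ->.
by move=> ki; apply/eqP/negPn/negP => /h; rewrite ltnNge ki.
Qed.

Lemma flagS k l : (k <= l)%N -> {subset flag k <= flag l}.
Proof. by move=> kl v; rewrite -!level_le => /leq_trans; apply. Qed.

Lemma flag0 v : (v \in flag 0) = (v == 0).
Proof. by rewrite /flag take0 span_nil memv0. Qed.

Lemma flag_full v : v \in flag r.
Proof. by apply/mem_flagP => i; rewrite leqNgt ltn_ord. Qed.

Lemma mem_flag_e i k : (e`_i \in flag k) = (i < k)%N.
Proof.
apply/mem_flagP/idP => [h|ik j kj]; last first.
  by rewrite coord_e -val_eqE gtn_eqF // (leq_trans ik).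
rewrite ltnNge; apply/negP => /h /eqP.
by rewrite coord_e eqxx oner_eq0.
Qed.

Lemma monic_flag i v : monic_at i v -> v \in flag i.+1.
Proof.
move=> m; rewrite -(subrK e`_i v) memvD ?mem_flag_e //.
exact: flagS m.
Qed.

Lemma monic_coord i v : monic_at i v -> coord e i v = 1.
Proof.
by move=> /mem_flagP/(_ i (leqnn _)); rewrite linearB /= coord_e eqxx => /subr0_eq.
Qed.

Lemma monic_neq0 i v : monic_at i v -> v != 0.
Proof.
by move/monic_coord => h; apply/eqP => v0; move/eqP: h; rewrite v0 linear0 eq_sym oner_eq0.
Qed.

Lemma monicE i v : monic_at i v = (v \in flag i.+1) && (coord e i v == 1).
Proof.
apply/idP/andP => [m|[/mem_flagP vi /eqP v1]].
  by rewrite monic_flag // monic_coord.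
apply/mem_flagP => j; rewrite leq_eqVlt => /predU1P[/val_inj<-|ij].
  by rewrite linearB /= coord_e eqxx v1 subrr.
by rewrite linearB /= coord_e vi // -val_eqE gtn_eqF // subrr.
Qed.

Lemma monic_level i v : monic_at i v -> level v = i.+1.
Proof.
move=> m; apply/anti_leq; rewrite level_le monic_flag //=.
rewrite /level (bigD1 i) /=; first exact: leq_maxl.
by rewrite monic_coord ?oner_eq0.
Qed.

Lemma monic_inj i j v : monic_at i v -> monic_at j v -> i = j.
Proof. by move=> /monic_level vi /monic_level; rewrite vi => -[/val_inj]. Qed.

Lemma monic_normalize v :
  v != 0 ->
  exists i, [/\ level v = i.+1, coord e i v != 0 & monic_at i ((coord e i v)^-1 *: v)].
Proof.
move=> v0; pose P i := coord e i v != 0.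
have [i0 Pi0] : exists i, P i.
  apply/existsP; rewrite -[X in is_true X]negbK negb_exists.
  apply: contra v0 => /forallP h.
  rewrite [v]coord_sumE big1 // => i _; move: (h i).
  by rewrite negbK => /eqP->; rewrite scale0r.
have := eq_bigmax_cond (fun i : 'I_r => i.+1) (_ : (0 < #|P|)%N).
case; first by apply/card_gt0P; exists i0.
move=> i Pi lev; exists i; split=> //.
rewrite monicE linearZ /= mulVf // eqxx andbT memvZ // -level_le /level lev //.
Qed.

Lemma level_monicB i v w : monic_at i v -> monic_at i w -> (level (v - w) <= i)%N.
Proof.
move=> mv mw; rewrite level_le.
have -> : v - w = (v - e`_i) - (w - e`_i) by rewrite opprB addrA subrK.
exact: memvB.
Qed.
End Flag.

(** * Independence of the standard monomials in a tower of fields *)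

Section StandardMonomials.
Variables (F : finFieldType) (V : vectType F) (r : nat) (e : r.-tuple V).
Local Notation fV := (finvect_type V).

Local Notation index N := ({ffun 'I_r -> fV} * {ffun 'I_r -> 'I_N.+1})%type.

(** The value [0] at [i] means that no vector is chosen at [i]. *)
Definition configs : {set {ffun 'I_r -> fV}} :=
  [set c : {ffun 'I_r -> fV} | [forall i, (c i == 0) || monic_at e i (c i)]].
Definition vsupp (c : {ffun 'I_r -> fV}) : {set 'I_r} := [set i | c i != 0].
Definition nsupp N (m : {ffun 'I_r -> 'I_N.+1}) : {set 'I_r} :=
  [set i | m i != 0 :> nat].

(** The pair [(c, m)] encodes the product of the [c i ^- m i].  The bound [N] on the
exponents makes the set of indices finite; it is large enough for the products of
degree at most [N]. *)
Definition monomials N : {set index N} :=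
  [set x : index N | (x.1 \in configs) && (vsupp x.1 == nsupp x.2)].

Lemma configsP (c : {ffun 'I_r -> fV}) :
  reflect (forall i, c i = 0 \/ monic_at e i (c i)) (c \in configs).
Proof.
rewrite inE; apply: (iffP forallP) => h i; first by case/orP: (h i) => [/eqP|]; auto.
by case: (h i) => ->; rewrite ?eqxx ?orbT.
Qed.

Hypothesis basis_e : basis_of {:V} e.

Lemma monomialsP N (x : index N) :
  reflect (forall i, (x.1 i = 0 /\ x.2 i = 0 :> nat) \/
                     (monic_at e i (x.1 i) /\ (0 < x.2 i)%N))
    (x \in monomials N).
Proof.
rewrite inE; apply: (iffP andP) => [[/configsP xc /eqP/setP xs] i|h].
  move/(_ i): xs; rewrite !inE => xs.
  case: (xc i) => [x0|m]; [left | right]; split=> //.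
    by move: xs; rewrite x0 eqxx => /esym/negbFE/eqP.
  by rewrite lt0n -xs (monic_neq0 basis_e m).
split; first by apply/configsP => i; case: (h i) => -[]; auto.
apply/eqP/setP => i; rewrite !inE; case: (h i) => [[-> ->]|[m]].
  by rewrite !eqxx.
by rewrite lt0n => ->; rewrite (monic_neq0 basis_e m).
Qed.

(** Independence of the standard monomials, at a point with values in a field [L] that is
built by adjoining one indeterminate for each basis vector.  In the step from [k] to
[k + 1], the terms of a relation are grouped by the factor at the index [k], which is
a power of some [('X + phi v)^-1]; by uniqueness of partial fractions each group is a
relation over the previous field.  In such a group all factors at indices [>= k] are
the same, which is why the relations considered are restricted to index sets [S]
whose elements agree from [k] on. *)
Lemma generic_point N k : (k <= r)%N ->
  exists (L : fieldType) (iota : {rmorphism F -> L}) (phi : V -> L),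
    [/\ forall a u v, phi (a *: u + v) = iota a * phi u + phi v,
        forall v, v \in flag e k -> v != 0 -> phi v != 0,
        forall v, (forall i : 'I_r, (i < k)%N -> coord e i v = 0) -> phi v = 0 &
        forall (S : pred (index N)) a,
          {subset S <= monomials N} ->
          {in S &, forall (x y : index N) (i : 'I_r), (k <= i)%N ->
             x.1 i = y.1 i /\ x.2 i = y.2 i} ->
          \sum_(x | S x) iota (a x) *
             \prod_(i < r | (i < k)%N) phi (x.1 i) ^- x.2 i = 0 ->
          forall x, S x -> a x = 0].
Proof.
elim: k => [_|k IH kr].
  exists F, (idfun : {rmorphism F -> F}), (fun=> 0); split=> //.
  - by move=> a u v; rewrite mulr0 addr0.
  - by move=> v; rewrite flag0 => ->.
  move=> S a _ agree + x Sx.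
  rewrite (big_pred1 x) => [|y]; first by rewrite big1 ?mulr1.
  apply/idP/eqP => [Sy|->] //; rewrite [x]surjective_pairing [y]surjective_pairing.
  by congr (_, _); apply/ffunP => i; case: (agree y x Sy Sx i (leq0n _)).
have {IH} [L [iota [phi [lin nz vanish indep]]]] := IH (ltnW kr).
pose i0 := Ordinal kr.
(* the image of [e`_k] is the new indeterminate, as [phi] vanishes on [e`_k] *)
pose psi v : {poly L} := (phi v)%:P + iota (coord e i0 v) *: 'X.
have phiB u v : phi (u - v) = phi u - phi v.
  by rewrite addrC -scaleN1r lin rmorphN1 mulN1r addrC.
exists {fraction {poly L}}, (@FracField.tofrac _ \o @polyC L \o iota : {rmorphism F -> _}).
exists (fun v => (psi v)%:F); split.
- move=> a u v; rewrite /= -!tofracM -tofracD; congr _%:F.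
  rewrite /psi lin linearP /= [iota (_ + _)]rmorphD [iota (_ * _)]rmorphM /=.
  rewrite polyCD polyCM scalerDl -scalerA.
  by rewrite mulrDr -!mul_polyC !addrA [_ + _ + (phi v)%:P]addrAC.
- move=> v vk v0; rewrite tofrac_eq0.
  have [c0|c0] := eqVneq (coord e i0 v) 0.
    rewrite /psi c0 rmorph0 scale0r addr0 polyC_eq0 nz //.
    apply/(mem_flagP basis_e) => i; rewrite leq_eqVlt => /predU1P[ki|ki].
      by have -> : i = i0 by apply: val_inj.
    by apply: (mem_flagP basis_e _ _ vk).
  apply/negP => /eqP/(congr1 (fun p : {poly L} => p`_1)).
  rewrite /psi coefD coefC coefZ coefX coef0 /= add0r mulr1 => /eqP.
  by rewrite fmorph_eq0 (negPf c0).
- move=> v h; rewrite /psi h //= rmorph0 scale0r addr0 vanish => [|i ik].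
    by rewrite polyC0 tofrac0.
  by rewrite h // ltnS ltnW.
move=> S a Sstd agree sum0 x Sx.
pose J : finType := (fV * 'I_N.+1)%type.
pose at0 (y : index N) : J := (y.1 i0, y.2 i0).
pose P (p : J) := ((p.1 == 0) && (p.2 == 0 :> nat)) || (monic_at e i0 p.1 && (0 < p.2)%N).
pose X (p : J) : L := \sum_(y | S y && (at0 y == p))
   iota (a y) * \prod_(i < r | (i < k)%N) phi (y.1 i) ^- y.2 i.
have SP y : S y -> P (at0 y).
  move/Sstd/monomialsP/(_ i0); rewrite /P /= => -[[-> ->]|[-> ->]].
    by rewrite !eqxx.
  by rewrite orbT.
have X0 : forall p, P p -> X p = 0.
  apply: (@partial_fractions L J P (fun p => phi p.1) (fun p => p.2) X).
    move=> [v l] [v' l'] Pp Pq /= ll h; move: Pp Pq.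
    rewrite unfold_in /P /= unfold_in /=; move/val_inj: ll h => <-.
    have [->|l0] := eqVneq (l : nat) 0%N.
      by rewrite !andbF !orbF !andbT => _ /eqP-> /eqP->.
    rewrite !andbF lt0n l0 !andbT /= => /(_ isT) vv' mv mv'; congr (_, _).
    apply: (@subr0_eq V); apply/eqP/negPn/negP.
    have vv : (v : V) - (v' : V) \in flag e k.
      by rewrite -level_le //; apply: (level_monicB basis_e mv mv').
    by move=> /(nz _ vv); rewrite phiB vv' subrr eqxx.
  rewrite -[RHS]sum0 (partition_big at0 P) //=; apply: eq_bigr => p Pp.
  rewrite /X !rmorph_sum /= mulr_suml; apply: eq_bigr => y /andP[Sy /eqP yp].
  rewrite !rmorphM /= -mulrA; congr (_ * _).
  rewrite [RHS](bigD1 i0) //= mulrC; congr (_ * _).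
    move: Pp; rewrite -yp /P /= => /orP[/andP[_ /eqP ->]|/andP[m _]].
      by rewrite !expr0.
    by rewrite /psi (monic_coord basis_e m) rmorph1 scale1r addrC.
  rewrite !rmorph_prod /=; apply: eq_big => i.
    by rewrite ltnS ltn_neqAle andbC -val_eqE.
  move=> ik.
  have -> : psi (y.1 i) = (phi (y.1 i))%:P.
    rewrite /psi.
    have -> : coord e i0 (y.1 i) = 0.
      case: (monomialsP _ (Sstd _ Sy) i) => -[h _]; first by rewrite h linear0.
      by apply: (mem_flagP basis_e _ _ (monic_flag basis_e h)).
    by rewrite rmorph0 scale0r addr0.
  pose f : {rmorphism L -> {fraction {poly L}}} := @FracField.tofrac _ \o @polyC L.
  by rewrite -[LHS]/(f _) fmorphV rmorphXn.
have Sp : {subset [pred y | S y && (at0 y == at0 x)] <= monomials N}.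
  by move=> y /andP[/Sstd].
apply: (indep _ a Sp) => [y z /andP[Sy /eqP yx] /andP[Sz /eqP zx] i||]; last 1 first.
- by rewrite /= Sx eqxx.
- rewrite leq_eqVlt => /predU1P[ki|]; last exact: agree.
  have -> : i = i0 by apply: val_inj.
  by move: yx; rewrite -zx => -[-> ->].
exact: X0 (SP _ Sx).
Qed.
End StandardMonomials.

(** * The standard monomials form a basis *)

Section Basis.
Variables (F : finFieldType) (V : vectType F) (r : nat) (e : r.-tuple V).
Hypothesis basis_e : basis_of {:V} e.
Local Notation fV := (finvect_type V).
Local Notation index N := ({ffun 'I_r -> fV} * {ffun 'I_r -> 'I_N.+1})%type.
Implicit Types (s : seq V) (u v w : V).

Definition recip v : symFrac V := (toFrac (symInj v))^-1.

Definition monomial N (x : index N) : symFrac V :=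
  \prod_(i < r) recip (x.1 i) ^+ x.2 i.

Lemma scale_symFracE (c : F) (x : symFrac V) : c *: x = toFrac c%:MP * x.
Proof. by []. Qed.

Lemma scale_symFracAl (c : F) (x y : symFrac V) : c *: (x * y) = (c *: x) * y.
Proof. by rewrite !scale_symFracE mulrA. Qed.

Lemma scale_symFracAr (c : F) (x y : symFrac V) : c *: (x * y) = x * (c *: y).
Proof. by rewrite mulrC scale_symFracAl mulrC. Qed.

(** Evaluation of polynomials at the generic point specializes a relation between
standard monomials in [K_V] to the same relation between their values, where it is
known to be trivial. *)
Lemma monomial_free N (a : index N -> F) :
  \sum_(x in monomials e N) a x *: monomial x = 0 ->
  forall x, x \in monomials e N -> a x = 0.
Proof.
move=> sum0.
have [L [iota [phi [lin nz _ indep]]]] := generic_point basis_e N (leqnn r).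
have phi0 : phi 0 = 0.
  have := lin 1 0 0; rewrite scale1r addr0 rmorph1 mul1r => /eqP.
  by rewrite -subr_eq subrr eq_sym => /eqP.
have phiD u v : phi (u + v) = phi u + phi v.
  by have := lin 1 u v; rewrite scale1r rmorph1 mul1r.
have phiZ c v : phi (c *: v) = iota c * phi v.
  by have := lin c v 0; rewrite phi0 !addr0.
pose ev : {rmorphism symAlg F V -> L} :=
  mmap iota (fun i => phi (vbasis {:V})`_i).
have evC c : ev c%:MP = iota c by rewrite /ev /= mmapC.
have evI v : ev (symInj v) = phi v.
  rewrite {2}(coord_vbasis (memvf v)) /symInj rmorph_sum /=.
  rewrite (big_morph phi phiD phi0); apply: eq_bigr => i _.
  by rewrite phiZ -mul_mpolyC rmorphM evC /= mmapX mmap1U.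
apply: (indep _ a (fun x => id)).
  by move=> x y _ _ i; rewrite leqNgt ltn_ord.
apply: (@specializes0 _ _ ev); rewrite -sum0.
apply: specializes_sum => x xm; rewrite scale_symFracE; apply: specializesM.
  by rewrite -evC; apply: specializes_tofrac.
rewrite (eq_bigl predT) => [|i]; last by rewrite ltn_ord.
apply: specializes_prod => i _; rewrite -exprVn.
case: (monomialsP basis_e _ xm i) => -[h1 h2].
  rewrite h2 !expr0 -(rmorph1 ev) -[X in specializes _ X](tofrac1 (symAlg F V)).
  exact: specializes_tofrac.
apply/specializesX/specializesV.
  by apply: nz; rewrite ?flag_full // (monic_neq0 basis_e h1).
by rewrite -evI; apply: specializes_tofrac.
Qed.

Definition recip_prod s : symFrac V := \prod_(v <- s) recip v.

Definition graded_monomials n : {set index n} :=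
  [set x in monomials e n | (\sum_(i < r) x.2 i == n)%N].

Definition in_span n (x : symFrac V) : Prop :=
  exists a : index n -> F, x = \sum_(y in graded_monomials n) a y *: monomial y.

Lemma in_spanD n x y : in_span n x -> in_span n y -> in_span n (x + y).
Proof.
move=> [a ->] [b ->]; exists (fun t => a t + b t).
by rewrite -big_split; apply: eq_bigr => t _; rewrite /= scalerDl.
Qed.

Lemma in_spanZ n c x : in_span n x -> in_span n (c *: x).
Proof.
move=> [a ->]; exists (fun t => c * a t).
by rewrite scaler_sumr; apply: eq_bigr => t _; rewrite scalerA.
Qed.

Lemma in_spanN n x : in_span n x -> in_span n (- x).
Proof. by rewrite -scaleN1r; apply: in_spanZ. Qed.

Lemma in_span_monomial n x :
  x \in graded_monomials n -> in_span n (monomial x).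
Proof.
move=> xm; exists (fun y => (y == x)%:R).
rewrite (bigD1 x) //= eqxx scale1r big1 ?addr0 // => y /andP[_ /negPf->].
by rewrite scale0r.
Qed.

Lemma symInj_eq0 v : (symInj v == 0) = (v == 0).
Proof.
apply/eqP/eqP => [v0|->]; last by rewrite linear0.
rewrite (coord_vbasis (memvf v)) big1 // => i _.
have /(congr1 (fun p => p@_U_(i))) := v0.
rewrite /symInj linear_sum mcoeff0 (bigD1 i) //= mcoeffZ mcoeffXU eqxx mulr1.
rewrite big1 ?addr0 => [->|j ji]; first by rewrite scale0r.
by rewrite mcoeffZ mcoeffXU (negPf ji) mulr0.
Qed.

Lemma toFrac_symInj_neq0 v : v != 0 -> toFrac (symInj v) != 0.
Proof. by rewrite -symInj_eq0 /toFrac tofrac_eq0. Qed.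

Lemma recipZ c v : recip (c *: v) = c^-1 *: recip v.
Proof.
rewrite /recip linearZ /= -mul_mpolyC /toFrac tofracM invfM scale_symFracE.
congr (_ * _); pose f : {rmorphism F -> symFrac V} :=
  @FracField.tofrac _ \o @mpolyC (\dim {:V}) F.
by rewrite -[LHS]/((f c)^-1) -fmorphV.
Qed.

Lemma inv_mul_subE (K : fieldType) (x y : K) : x != 0 -> y != 0 -> x - y != 0 ->
  x^-1 * y^-1 = (x - y)^-1 * y^-1 - (x - y)^-1 * x^-1.
Proof.
move=> x0 y0 xy0; rewrite -mulrBr; apply: (canRL (mulKf xy0)).
by rewrite mulrBl mulrA divff // mul1r mulrCA divff // mulr1.
Qed.

Lemma toFracB (p q : symAlg F V) : toFrac (p - q) = toFrac p - toFrac q.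
Proof. exact: tofracB. Qed.

Lemma toFracD (p q : symAlg F V) : toFrac (p + q) = toFrac p + toFrac q.
Proof. exact: tofracD. Qed.

Lemma toFracM (p q : symAlg F V) : toFrac (p * q) = toFrac p * toFrac q.
Proof. exact: tofracM. Qed.

Lemma toFrac_eq0 (p : symAlg F V) : (toFrac p == 0) = (p == 0).
Proof. exact: tofrac_eq0. Qed.

(** If [v] and [w] are monic at the same index then [v - w] has a smaller level than both,
so that this relation rewrites a product into products of smaller total level. *)
Lemma recip_mul v w : v != 0 -> w != 0 -> v - w != 0 ->
  recip v * recip w = recip (v - w) * recip w - recip (v - w) * recip v.
Proof.
move=> /toFrac_symInj_neq0 v0 /toFrac_symInj_neq0 w0 /toFrac_symInj_neq0.
rewrite /recip linearB /= toFracB => vw0.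
exact: (@inv_mul_subE (symFrac V) (toFrac (symInj v)) (toFrac (symInj w)) v0 w0 vw0).
Qed.

Lemma recip_prod_cons v s : recip_prod (v :: s) = recip v * recip_prod s.
Proof. exact: big_cons. Qed.

(** The reciprocals of the multiples of a vector are proportional, so only vectors with
leading coordinate [1] matter. *)
Lemma recip_prod_normalize s : all (fun v => v != 0) s ->
  exists c s', [/\ size s' = size s,
    (\sum_(v <- s') level e v = \sum_(v <- s) level e v)%N,
    {in s', forall v, exists i, monic_at e i v} & recip_prod s = c *: recip_prod s'].
Proof.
elim: s => [_|v s IH /= /andP[v0 /IH[c [s' [sz lev mon gs]]]]].
  by exists 1, [::]; split=> //; rewrite scale1r.
have [i [lv cv mv]] := monic_normalize basis_e v0.
set k := coord e i v in cv mv.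
exists (k^-1 * c), ((k^-1 *: v) :: s'); split=> /=.
- by rewrite sz.
- by rewrite !big_cons lev lv (monic_level basis_e mv).
- by move=> w /predU1P[->|/mon //]; exists i.
rewrite !recip_prod_cons -{1}[v](scalerKV cv) recipZ gs.
by rewrite -scale_symFracAl -scale_symFracAr scalerA.
Qed.

(** When all factors of the same level coincide, the product is the standard monomial
whose exponent at [i] is the number of factors monic at [i]. *)
Lemma recip_prod_std s : {in s, forall v, exists i, monic_at e i v} ->
  {in s &, forall v w, level e v = level e w -> v = w} ->
  in_span (size s) (recip_prod s).
Proof.
move=> mon inj; set n := size s.
pose at_level (i : 'I_r) v := level e v == i.+1.
pose c : {ffun 'I_r -> fV} :=
  [ffun i => nth 0 s (find (at_level i) s) : fV].
pose m : {ffun 'I_r -> 'I_n.+1} := [ffun i => inord (count (at_level i) s)].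
have mE i : m i = count (at_level i) s :> nat.
  by rewrite ffunE inordK // ltnS count_size.
have cE i v : v \in s -> at_level i v -> c i = v.
  move=> vs iv; have hs : has (at_level i) s by apply/hasP; exists v.
  rewrite ffunE; apply: inj => //; first by rewrite mem_nth -?has_find.
  by rewrite (eqP iv); apply/eqP; apply: (nth_find _ hs).
have lev1 v : v \in s -> exists i : 'I_r, at_level^~ v =1 pred1 i.
  move=> /mon[i /(monic_level basis_e) iv]; exists i => j.
  by rewrite /at_level iv eqSS eq_sym.
have -> : recip_prod s = monomial (c, m).
  rewrite /recip_prod /monomial.
  transitivity (\prod_(v <- s) \prod_(i | at_level i v) recip v).
    by apply: eq_big_seq => v /lev1[i iv]; rewrite (eq_bigl _ _ iv) big_pred1_eq.
  rewrite (exchange_big_dep xpredT) //=; apply: eq_bigr => i _.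
  rewrite mE -iter_mulr_1 -big_const_seq big_seq_cond [RHS]big_seq_cond.
  by apply: eq_bigr => v /andP[vs iv]; rewrite (cE i v).
apply: in_span_monomial; rewrite inE; apply/andP; split.
  apply/(monomialsP basis_e) => i /=; rewrite mE -has_count.
  have [hs|hs] := boolP (has (at_level i) s); [right | left].
    case/hasP: hs => v vs iv; rewrite (cE i v) //; split=> //.
    have [j vj] := mon v vs; suff -> : i = j by [].
    by apply: val_inj; move: iv; rewrite /at_level (monic_level basis_e vj) => /eqP[].
  split; first by rewrite ffunE nth_default // hasNfind.
  by move: hs; rewrite has_count -eqn0Ngt => /eqP.
apply/eqP; transitivity (\sum_(v <- s) 1)%N; last exact: sum1_size.
transitivity (\sum_(v <- s) \sum_(i | at_level i v) 1)%N; last first.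
  by apply: eq_big_seq => v /lev1[i iv]; rewrite (eq_bigl _ _ iv) big_pred1_eq.
rewrite (exchange_big_dep xpredT) //=; apply: eq_bigr => i _.
by rewrite mE sum1_count.
Qed.

(** Straightening, by induction on the sum of the levels: either no two distinct factors
are monic at the same index, or [recip_mul] applies to them. *)
Lemma recip_prod_in_span s : all (fun v => v != 0) s -> in_span (size s) (recip_prod s).
Proof.
have [b] := ubnP (\sum_(v <- s) level e v)%N; elim: b => // b IH in s *.
rewrite ltnS => bs /recip_prod_normalize[c [s' [sz lev mon ->]]].
apply: in_spanZ; rewrite -{}sz; rewrite -{}lev in bs.
have [/allP h|/allPn[[v w] /allpairsP[[v' w'] /= [vs ws [-> ->]]]]] :=
  boolP (all (fun p => (level e p.1 == level e p.2) ==> (p.1 == p.2))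
             [seq (v, w) | v <- s', w <- s']).
  apply: recip_prod_std => // v w vs ws vw.
  by have /implyP/(_ _)/eqP := h (v, w) (allpairs_f pair vs ws); apply; apply/eqP.
rewrite /= negb_imply => /andP[/eqP lvw nvw].
have w_in : w' \in rem v' s'.
  by have := ws; rewrite (perm_mem (perm_to_rem vs)) in_cons eq_sym (negPf nvw).
set t := rem w' (rem v' s').
have ps : perm_eq s' [:: v', w' & t].
  by rewrite (perm_trans (perm_to_rem vs)) // perm_cons perm_to_rem.
have [[i mv] [j mw]] := (mon _ vs, mon _ ws).
have ij : i = j.
  apply: val_inj; move: lvw.
  by rewrite !(monic_level basis_e mv, monic_level basis_e mw) => -[].
rewrite -{j}ij in mw.
have tn0 : all (fun v => v != 0) t.
  apply/allP => u /mem_rem/mem_rem/mon[k]; exact: monic_neq0.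
have vw0 : v' - w' != 0 by rewrite subr_eq0.
have [v0 w0] := (monic_neq0 basis_e mv, monic_neq0 basis_e mw).
rewrite (perm_size ps) [recip_prod s'](perm_big _ ps) -/(recip_prod _) !recip_prod_cons mulrA.
rewrite recip_mul // mulrBl -!mulrA -!recip_prod_cons.
rewrite (perm_big _ ps) !big_cons lvw /= in bs.
have lvl := level_monicB basis_e mv mw.
rewrite (monic_level basis_e mw) in bs.
apply: in_spanD; last apply: in_spanN.
  apply: (IH [:: v' - w', w' & t]); last by rewrite /= vw0 w0.
  by rewrite !big_cons (monic_level basis_e mw) (leq_trans _ bs) // ltn_add2r ltnS.
apply: (IH [:: v' - w', v' & t]); last by rewrite /= vw0 v0.
by rewrite !big_cons (monic_level basis_e mv) (leq_trans _ bs) // ltn_add2r ltnS.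
Qed.

Lemma monomial_recip_prod n x : x \in graded_monomials n ->
  exists2 s, size s = n & all (fun v => v != 0) s /\ monomial x = recip_prod s.
Proof.
rewrite inE => /andP[xm /eqP xn].
exists (flatten [seq nseq (x.2 i) (x.1 i : V) | i <- enum 'I_r]).
  rewrite size_flatten /shape -map_comp sumnE big_map -[RHS]xn big_enum.
  by apply: eq_bigr => i _ /=; rewrite size_nseq.
split.
  apply/allP => v /flattenP[_ /mapP[i _ ->]]; rewrite mem_nseq => /andP[x2 /eqP->].
  case: (monomialsP basis_e _ xm i) => -[]; last by move/(monic_neq0 basis_e).
  by move=> _ x0; rewrite x0 in x2.
rewrite /recip_prod big_flatten big_map big_enum; apply: eq_bigr => i _ /=.
by rewrite big_nseq iter_mulr_1.
Qed.

Lemma RVdegP n x : RVdeg n x <-> in_span n x.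
Proof.
split=> [[m [c [v [v0 ->]]]]|[a ->]].
  apply: (big_ind (in_span n)) => [||i _]; last apply: in_spanZ.
  - by exists (fun=> 0); rewrite big1 // => y _; rewrite scale0r.
  - exact: in_spanD.
  have := @recip_prod_in_span [seq v i j | j <- enum 'I_n] _.
  rewrite size_map size_enum_ord /recip_prod big_map big_enum; apply.
  by apply/allP => _ /mapP[j _ ->].
pose G := graded_monomials n.
have /fin_all_exists2 [s sz sP] (i : 'I_#|G|) : exists2 s, size s = n &
    all (fun v => v != 0) s /\ monomial (enum_val i) = recip_prod s.
  exact/monomial_recip_prod/enum_valP.
exists #|G|, (fun i => a (enum_val i)), (fun i j => (s i)`_j); split.
  by move=> i j; have [/allP + _] := sP i; apply; rewrite mem_nth ?sz.
rewrite big_enum_val; apply: eq_bigr => i _; congr (_ *: _).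
by have [_ ->] := sP i; rewrite /recip_prod (big_nth 0) sz big_mkord.
Qed.

End Basis.

(** * The action on the field of fractions *)

Lemma scale_add_frac (K : fieldType) (t u v w z : K) : v != 0 -> z != 0 ->
  t * (u / v) + w / z = (t * u * z + w * v) / (v * z).
Proof. by move=> v0 z0; rewrite mulrA addf_div. Qed.

Section FracAction.
Variables (F : finFieldType) (V : vectType F).
Local Notation fV := (finvect_type V).

(** The membership proof is an argument so that linearity can be attached to the function
as a structure; likewise for [fracAut] below. *)
Definition autFun (g : {perm fV}) of g \in autV V := fun v : V => g v : V.

Fact autFun_linear g (autg : g \in autV V) : linear (autFun autg).
Proof. exact/autVP. Qed.
HB.instance Definition _ g (autg : g \in autV V) :=
  GRing.isLinear.Build F V V *:%R (autFun autg) (autFun_linear autg).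

Section OneAut.
Variables (g : {perm fV}) (autg : g \in autV V).
Local Notation gV := (autFun autg).

Let autFunK : cancel gV (autFun (groupVr autg)).
Proof. exact: (permK g). Qed.

Definition fracAut of g \in autV V := fun x : symFrac V => fracMap (g : V -> V) x.
Local Notation gK := (fracAut autg).

Lemma fracAut_div p q : q != 0 ->
  gK (toFrac p / toFrac q) = toFrac (symMap gV p) / toFrac (symMap gV q).
Proof. exact: (@fracMap_div F V gV _ p q autFunK). Qed.

Lemma symMap1 : symMap gV 1 = 1.
Proof. by rewrite /symMap rmorph1. Qed.

Lemma symMapD p q : symMap gV (p + q) = symMap gV p + symMap gV q.
Proof. by rewrite /symMap linearD. Qed.

Lemma symMapC c : symMap gV c%:MP = c%:MP.
Proof. exact: comp_mpolyC. Qed.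

Lemma symMap_neq0 q : q != 0 -> symMap gV q != 0.
Proof. by rewrite (symMap_eq0 _ autFunK). Qed.

Lemma toFrac_div_ex (x : symFrac V) : exists p q, q != 0 /\ x = toFrac p / toFrac q.
Proof.
exists \n_(repr x), \d_(repr x); have d0 := denom_ratioP (repr x).
by rewrite -fracE mulfK // /toFrac tofrac_eq0.
Qed.

Lemma fracAut_tofrac p : gK (toFrac p) = toFrac (symMap gV p).
Proof.
have := @fracAut_div p 1 (oner_neq0 _).
by rewrite symMap1 /toFrac tofrac1 !divr1.
Qed.

Fact fracAut_monoid : monoid_morphism gK.
Proof.
split=> [|x y]; first by rewrite -(tofrac1 (symAlg F V)) fracAut_tofrac symMap1.
have [p [q [q0 ->]]] := toFrac_div_ex x; have [p' [q' [q0' ->]]] := toFrac_div_ex y.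
have mulE := @mulf_div (symFrac V).
rewrite mulE -!toFracM (fracAut_div p q0) (fracAut_div p' q0') mulE -!toFracM.
by rewrite fracAut_div ?mulf_neq0 // !symMapM.
Qed.

Fact fracAut_linear : linear gK.
Proof.
move=> c x y.
have [p [q [q0 ->]]] := toFrac_div_ex x; have [p' [q' [q0' ->]]] := toFrac_div_ex y.
have sumE (t u v w z : symFrac V) : v != 0 -> z != 0 ->
    t * (u / v) + w / z = (t * u * z + w * v) / (v * z).
  exact: scale_add_frac.
rewrite !scale_symFracE (fracAut_div p q0) (fracAut_div p' q0').
rewrite sumE ?toFrac_eq0 // sumE ?toFrac_eq0 ?symMap_neq0 //.
rewrite -!(toFracM, toFracD) fracAut_div ?mulf_neq0 //.
by rewrite !(symMapM, symMapD, symMapC).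
Qed.

HB.instance Definition _ := GRing.isLinear.Build F (symFrac V) (symFrac V) *:%R gK fracAut_linear.
HB.instance Definition _ := GRing.isMonoidMorphism.Build (symFrac V) (symFrac V) gK fracAut_monoid.

Lemma fracAut_recip (v : V) : gK (recip v) = recip (g v : V).
Proof. by rewrite /recip fmorphV /= fracAut_tofrac (symMap_symInj (autFun autg)). Qed.

End OneAut.

(** Permutations are composed from left to right, hence the order of the factors. *)
Lemma fracAut_comp (g h : {perm fV}) (autg : g \in autV V) (auth : h \in autV V)
  (autgh : (g * h)%g \in autV V) x :
  fracAut autgh x = fracAut auth (fracAut autg x).
Proof.
have [p [q [q0 ->]]] := toFrac_div_ex x.
have symE t : symMap (autFun autgh) t = symMap (autFun auth) (symMap (autFun autg) t).
  rewrite symMap_comp; congr comp_mpoly; apply: eq_from_tnth => i.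
  by rewrite !tnth_mktuple /autFun /= permM.
rewrite (fracAut_div autgh p q0) (fracAut_div autg p q0).
by rewrite (fracAut_div auth _ (symMap_neq0 autg q0)) !symE.
Qed.

Lemma fracAut1 (aut1 : (1 : {perm fV})%g \in autV V) x : fracAut aut1 x = x.
Proof.
have [p [q [q0 ->]]] := toFrac_div_ex x; rewrite fracAut_div //.
by congr (toFrac _ / toFrac _); rewrite -[RHS]symMap_id; congr comp_mpoly;
  apply: eq_from_tnth => i; rewrite !tnth_mktuple /autFun /= perm1.
Qed.

End FracAction.

(** * Invariants of a permuted basis *)

Lemma hasDim_iso (F : fieldType) (E E' : lmodType F) (f : {linear E -> E'})
    (g : E' -> E) (W : E -> Prop) (W' : E' -> Prop) d :
  cancel f g -> cancel g f -> (forall y, W' y <-> W (g y)) ->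
  hasDim W d -> hasDim W' d.
Proof.
move=> fK gK WE [b [bW bfree]]; exists (f \o b); split=> [y|c].
  rewrite WE bW; split=> -[c e]; exists c.
    by rewrite -[LHS]gK e linear_sum; apply: eq_bigr => i _; rewrite linearZ.
  rewrite -[RHS]fK e linear_sum; congr g.
  by apply: eq_bigr => i _; rewrite linearZ.
move=> e; apply: bfree; rewrite -[LHS]fK linear_sum -[RHS]fK linear0; congr g.
by rewrite -[RHS]e; apply: eq_bigr => i _; rewrite linearZ.
Qed.

Section PermutedBasis.
Variables (F : fieldType) (E : lmodType F) (I : finType) (gT : finGroupType).
Variables (H : {group gT}) (to : {action gT &-> I}) (S : {set I}).
Variables (b : I -> E) (act : gT -> {linear E -> E}).
Hypothesis actsHS : [acts H, on S | to].
Hypothesis act_b : forall h i, h \in H -> i \in S -> act h (b i) = b (to i h).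
Hypothesis b_free : forall a, \sum_(i in S) a i *: b i = 0 ->
  forall i, i \in S -> a i = 0.

Let O := orbit to H @: S.

Lemma sum_orbits (C : {set I} -> F) :
  \sum_(o in O) C o *: \sum_(i in o) b i = \sum_(i in S) C (orbit to H i) *: b i.
Proof.
rewrite [RHS](partition_big_imset (orbit to H)); apply: eq_bigr => o /imsetP[i iS ->].
rewrite scaler_sumr; apply: eq_big => j; last by move/orbit_eqP->.
apply/idP/andP => [ji|[_ /eqP <-]]; last exact: orbit_refl.
by rewrite -(acts_sub_orbit _ actsHS) in iS; split; [apply: (subsetP iS) | apply/eqP/orbit_eqP].
Qed.

Lemma invariant_coef a : (forall h, h \in H ->
    act h (\sum_(i in S) a i *: b i) = \sum_(i in S) a i *: b i) ->
  forall i j, i \in S -> j \in orbit to H i -> a j = a i.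
Proof.
move=> inv i _ iS /orbitP[h hH <-].
have e : act h^-1%g (\sum_(i in S) a i *: b i) = \sum_(i in S) a (to i h) *: b i.
  rewrite linear_sum (reindex_acts _ actsHS hH); apply: eq_bigr => j jS /=.
  by rewrite linearZ /= act_b ?groupV ?actK // (acts_act actsHS).
move: (inv _ (groupVr hH)); rewrite e.
move/eqP; rewrite -subr_eq0 -sumrB => /eqP.
rewrite (eq_bigr (fun i => (a (to i h) - a i) *: b i)) => [|j _]; last by rewrite scalerBl.
by move/(b_free (a := fun i => a (to i h) - a i))/(_ i iS)/subr0_eq.
Qed.

(** A combination of the permuted basis is invariant if and only if its coefficients are
constant on orbits; hence the sums over the orbits form a basis of the invariants. *)
Lemma hasDim_orbits :
  hasDim (fun x => (exists a, x = \sum_(i in S) a i *: b i) /\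
                   forall h, h \in H -> act h x = x) #|O|.
Proof.
pose B (j : 'I_#|O|) := \sum_(i in enum_val j) b i.
have sumB c (C : {set I} -> F) : (forall j : 'I_#|O|, c j = C (enum_val j)) ->
    \sum_j c j *: B j = \sum_(i in S) C (orbit to H i) *: b i.
  move=> cC; rewrite -sum_orbits [RHS]big_enum_val; apply: eq_bigr => j _.
  by rewrite cC.
have ext c : exists C, forall j : 'I_#|O|, c j = C (enum_val j) :> F.
  (* the sum has one term, except at sets that are not orbits *)
  exists (fun o => \sum_(j | enum_val j == o) c j) => j.
  by rewrite (big_pred1 j) // => k; rewrite (inj_eq enum_val_inj).
exists B; split=> [x|c].
  split=> [[[a ->] inv]|[c]].
    pose C (o : {set I}) := if [pick i in o] is Some i then a i else 0.
    exists (fun j => C (enum_val j)); rewrite (sumB _ C) //.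
    apply: eq_bigr => i iS; congr (_ *: _); rewrite /C; case: pickP => [j ji|].
      by rewrite (invariant_coef inv iS ji).
    by move/(_ i); rewrite orbit_refl.
  have [C cC] := ext c; rewrite (sumB _ C) // => ->.
  split=> [|h hH]; first by exists (fun i => C (orbit to H i)).
  rewrite linear_sum [RHS](reindex_acts _ actsHS hH); apply: eq_bigr => i iS /=.
  by rewrite linearZ /= act_b // (orbit_eqP (mem_orbit _ _ hH)).
have [C cC] := ext c; rewrite (sumB _ C) // => /b_free h j.
have /imsetP[i iS ji] := enum_valP j.
by rewrite cC ji (h i).
Qed.
End PermutedBasis.

(** * Groups attached to the flag *)

Section FlagGroups.
Variables (F : finFieldType) (V : vectType F) (r : nat) (e : r.-tuple V).
Hypothesis basis_e : basis_of {:V} e.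
Local Notation fV := (finvect_type V).
Implicit Types (g h : {perm fV}) (i j : 'I_r) (s k l : nat) (v w : V).

(** For [s = r] this is the unitriangular group [U], and for [s <= r] it is the group
[U L_s], see [mul_unitri_parabolicL]. *)
Definition unitri s : {set {perm fV}} :=
  [set g in autV V | [forall j : 'I_r, (j < s)%N ==> monic_at e j (g e`_j)]].

Lemma unitriP s g : reflect
  (g \in autV V /\ forall j, (j < s)%N -> monic_at e j (g e`_j)) (g \in unitri s).
Proof.
rewrite [X in reflect _ X]in_set;  apply: (iffP andP) => -[-> h]; split=> //.
  by move=> j js; move/forallP/(_ j): h; rewrite js.
by apply/forallP => j; apply/implyP => js; apply: h.
Qed.

Lemma unitriangularE : unitriangular e = unitri r.
Proof.
apply/setP => g; rewrite /unitriangular /unitri [LHS]in_set [RHS]in_set.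
congr (_ && _); apply/forallP/forallP => h.
  move=> j; rewrite ltn_ord /=; apply/(mem_flagP basis_e) => i ji.
  move/(_ i)/forallP/(_ j): h; rewrite ji mxE => /eqP gij.
  by rewrite linearB /= gij coord_e // subrr.
move=> i; apply/forallP => j; apply/implyP => ji; rewrite mxE.
move: (h j); rewrite ltn_ord => /(mem_flagP basis_e)/(_ i ji)/eqP.
by rewrite linearB /= coord_e // subr_eq0.
Qed.

Lemma parabolicP s g : reflect
  (g \in autV V /\ forall j, (j < s)%N -> (g e`_j : V) \in flag e s)
  (g \in parabolic e s).
Proof.
rewrite [X in reflect _ X]in_set; apply: (iffP andP) => -[-> h]; split=> //.
  move=> j js; apply/(mem_flagP basis_e) => i si; apply/eqP.
  by move/forallP/(_ i)/forallP/(_ j): h; rewrite js si mxE.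
apply/forallP => i; apply/forallP => j; apply/implyP => /andP[js si].
by rewrite mxE; apply/eqP/(mem_flagP basis_e _ _ (h j js)).
Qed.

Lemma parabolicLP s g : reflect
  (g \in autV V /\ forall j, (j < s)%N -> g e`_j = e`_j)
  (g \in parabolicL e s).
Proof.
rewrite [X in reflect _ X]in_set; apply: (iffP andP) => -[-> h]; split=> //.
  move=> j js; rewrite [LHS](coord_sumE basis_e) [RHS](coord_sumE basis_e).
  apply: eq_bigr => i _; congr (_ *: _); rewrite coord_e //.
  by move/forallP/(_ i)/forallP/(_ j): h; rewrite js mxE => /eqP.
apply/forallP => i; apply/forallP => j; apply/implyP => js.
by rewrite mxE h // coord_e.
Qed.

Lemma autD g v w : g \in autV V -> g (v + w : V) = (g v : V) + g w.
Proof. by move=> autg; rewrite -!/(autFun autg _) linearD. Qed.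

Lemma autB g v w : g \in autV V -> g (v - w : V) = (g v : V) - g w.
Proof. by move=> autg; rewrite -!/(autFun autg _) linearB. Qed.

Lemma autZ g (a : F) v : g \in autV V -> g (a *: v : V) = a *: (g v : V).
Proof. by move=> autg; rewrite -!/(autFun autg _) linearZ. Qed.

Lemma aut0 g : g \in autV V -> g (0 : V) = 0.
Proof. by move=> autg; rewrite -!/(autFun autg _) linear0. Qed.

Lemma aut_coord g v : g \in autV V ->
  g v = \sum_i coord e i v *: (g e`_i : V).
Proof.
move=> autg; rewrite {1}(coord_sumE basis_e v) -!/(autFun autg _) linear_sum.
by apply: eq_bigr => i _; rewrite linearZ.
Qed.

Lemma aut_flag g k (W : {vspace V}) v : g \in autV V ->
  (forall j, (j < k)%N -> (g e`_j : V) \in W) -> v \in flag e k -> (g v : V) \in W.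
Proof.
move=> autg h /(mem_flagP basis_e) vk; rewrite aut_coord //.
apply: memv_suml => i _; have [ik|ki] := ltnP i k; first by rewrite memvZ ?h.
by rewrite vk // scale0r mem0v.
Qed.

Lemma unitri_flag s g k v : g \in unitri s -> (k <= s)%N ->
  v \in flag e k -> (g v : V) \in flag e k.
Proof.
move=> /unitriP[autg h] ks; apply: aut_flag => // j jk.
apply: (flagS basis_e jk); apply: monic_flag => //.
exact: h (leq_trans jk ks).
Qed.

Lemma unitri_monic s g i v : g \in unitri s -> (i < s)%N ->
  monic_at e i v -> monic_at e i (g v).
Proof.
move=> gs is_ vi; have /unitriP[autg h] := gs; rewrite /monic_at.
have -> : (g v : V) - e`_i = g (v - e`_i : V) + ((g e`_i : V) - e`_i).
  by rewrite autB // addrA subrK.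
by apply: memvD; [apply: unitri_flag gs (ltnW is_) vi | apply: h].
Qed.

Lemma unitri_group_set s : group_set (unitri s).
Proof.
apply/group_setP; split=> [|g h gs hs].
  by apply/unitriP; split=> [|j _]; rewrite ?group1 // perm1 /monic_at subrr mem0v.
have [/unitriP[autg gP] /unitriP[auth _]] := (gs, hs).
apply/unitriP; split=> [|j js]; first exact: groupM.
by rewrite permM; exact: unitri_monic hs js (gP j js).
Qed.
Canonical unitri_group s := Group (unitri_group_set s).

Lemma parabolic_flag s g v :
  g \in parabolic e s -> v \in flag e s -> (g v : V) \in flag e s.
Proof. by move=> /parabolicP[autg h]; apply: aut_flag. Qed.

Lemma parabolic_group_set s : group_set (parabolic e s).
Proof.
apply/group_setP; split=> [|g h gs hs].
  by apply/parabolicP; split=> [|j js]; rewrite ?group1 // perm1 mem_flag_e.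
have [/parabolicP[autg gP] /parabolicP[auth _]] := (gs, hs).
apply/parabolicP; split=> [|j js]; first exact: groupM.
by rewrite permM; exact: parabolic_flag hs (gP j js).
Qed.
Canonical parabolic_group s := Group (parabolic_group_set s).

Lemma parabolicL_flag s g v : g \in parabolicL e s -> v \in flag e s -> g v = v.
Proof.
move=> /parabolicLP[autg h] /(mem_flagP basis_e) vs.
rewrite aut_coord // [RHS](coord_sumE basis_e); apply: eq_bigr => i _.
have [is_|si] := ltnP i s; first by rewrite h.
by rewrite vs // !scale0r.
Qed.

Lemma parabolicL_group_set s : group_set (parabolicL e s).
Proof.
apply/group_setP; split=> [|g h gs hs].
  by apply/parabolicLP; split=> [|j js]; rewrite ?group1 // perm1.
have [/parabolicLP[autg gP] /parabolicLP[auth hP]] := (gs, hs).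
apply/parabolicLP; split=> [|j js]; first exact: groupM.
by rewrite permM gP ?hP.
Qed.
Canonical parabolicL_group s := Group (parabolicL_group_set s).

Lemma parabolicL_norm s : parabolic e s \subset ('N(parabolicL e s))%g.
Proof.
apply/subsetP => t tP; rewrite inE; apply/subsetP => _ /imsetP[l lL ->].
have /parabolicP[autt _] := tP; have /parabolicLP[autl _] := lL.
apply/parabolicLP; split=> [|j js]; first by rewrite groupJ.
rewrite conjgE !permM (parabolicL_flag lL) ?permKV //.
by apply: (parabolic_flag (groupVr tP)); rewrite mem_flag_e.
Qed.

Lemma unitri_sub_parabolic s : unitri s \subset parabolic e s.
Proof.
apply/subsetP => g gs; have /unitriP[autg _] := gs.
apply/parabolicP; split=> // j js; apply: (unitri_flag gs (leqnn s)).
by rewrite mem_flag_e.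
Qed.

Lemma aut_of_free (b : 'I_r -> V) :
  (forall a, \sum_i a i *: b i = 0 -> forall i, a i = 0) ->
  exists2 g, g \in autV V & forall i, g e`_i = b i.
Proof.
move=> bfree; pose f (v : fV) : fV := \sum_i coord e i v *: b i.
have flin : linear (f : V -> V).
  move=> a u v; rewrite /f scaler_sumr -big_split; apply: eq_bigr => i _.
  by rewrite linearP /= scalerDl scalerA.
have finj : injective f.
  move=> u v uv; apply: (@subr0_eq V).
  rewrite [LHS](coord_sumE basis_e) big1 // => i _.
  rewrite (bfree (fun i => coord e i ((u : V) - v))) ?scale0r //.
  have : f ((u : V) - (v : V)) = 0.
    by rewrite addrC -scaleN1r flin uv scaleN1r addNr.
  by [].
exists (perm finj); first by apply/autVP => a u v; rewrite !permE; apply: flin.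
move=> i; rewrite permE /f (bigD1 i) //= coord_e // eqxx scale1r big1 ?addr0 //.
by move=> j ji; rewrite coord_e // (negPf ji) scale0r.
Qed.

(** If [i] is the largest index with [c i] and [a i] nonzero, then the [i]-th coordinate of
the sum is [a i]. *)
Lemma config_coef (c : {ffun 'I_r -> fV}) k (a : 'I_r -> F) :
  c \in configs e -> \sum_i a i *: (c i : V) \in flag e k ->
  forall i, (k <= i)%N -> c i != 0 -> a i = 0.
Proof.
move=> /(configsP) cc /(mem_flagP basis_e) sk i0 ki0 ci0.
apply/eqP/negPn/negP => ai0.
pose Q := [pred i : 'I_r | (c i != 0) && (a i != 0)].
have Q0 : Q i0 by rewrite /= ci0.
case: (arg_maxnP (fun i : 'I_r => i : nat) Q0) => i /andP[ci ai] imax.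
have ki : (k <= i)%N by apply: leq_trans ki0 _; apply: imax.
have := sk i ki; rewrite linear_sum (bigD1 i) //= big1.
  case: (cc i) => [c0|m]; first by rewrite c0 eqxx in ci.
  by rewrite addr0 linearZ /= (monic_coord basis_e m) mulr1 => /eqP; rewrite (negPf ai).
move=> j ji; rewrite linearZ /=.
case: (cc j) => [->|m]; first by rewrite linear0 mulr0.
have [aj|aj] := eqVneq (a j) 0; first by rewrite aj mul0r.
have : (j <= i)%N by apply: imax; rewrite /= aj (monic_neq0 basis_e m).
rewrite leq_eqVlt => /predU1P[/val_inj jj|lt]; first by rewrite jj eqxx in ji.
by rewrite (mem_flagP basis_e _ _ (monic_flag basis_e m)) ?mulr0.
Qed.

Lemma monic_family_free (b : 'I_r -> V) a : (forall i, monic_at e i (b i)) ->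
  \sum_i a i *: b i = 0 -> forall i, a i = 0.
Proof.
move=> bm sum0 i.
apply: (@config_coef [ffun i => b i : fV] 0 a) => //.
- by apply/configsP => j; rewrite ffunE; right.
- by under eq_bigr do rewrite ffunE; rewrite sum0 mem0v.
by rewrite ffunE (monic_neq0 basis_e (bm i)).
Qed.

(** For [g] in [unitri s], let [u] agree with [g^-1] on the first [s] basis vectors and fix
the others.  Then [u] is unitriangular, and [u * g], which applies [u] first, fixes the
first [s] basis vectors. *)
Lemma mul_unitri_parabolicL s : (s <= r)%N ->
  (unitri r * parabolicL e s)%g = unitri s.
Proof.
move=> sr; apply/setP => g; apply/mulsgP/idP => [[u l ur ls ->]|gs].
  have [/unitriP[autu uP] /parabolicLP[autl _]] := (ur, ls).
  apply/unitriP; split=> [|j js]; first exact: groupM.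
  rewrite permM (parabolicL_flag ls); first exact: uP.
  by apply: (flagS basis_e js); apply: monic_flag => //; apply: uP.
have /unitriP[autg _] := gs; have /unitriP[_ gP] := groupVr gs.
pose b j : V := if (j < s)%N then g^-1%g e`_j else e`_j.
have bm j : monic_at e j (b j).
  by rewrite /b; case: ifP => [/gP //|_]; rewrite /monic_at subrr mem0v.
have [u autu uP] := aut_of_free (fun a => @monic_family_free b a bm).
have ur : u \in unitri r by apply/unitriP; split=> // j _; rewrite uP.
exists u^-1%g (u * g)%g; rewrite ?groupV ?mulKg //.
apply/parabolicLP; split=> [|j js]; first exact: groupM.
by rewrite permM uP /b js permKV.
Qed.

End FlagGroups.

(** * Counting double cosets block by block *)

Section DoubleCosetCount.
Variables (gT : finGroupType) (G P M L H : {group gT}) (B : {set gT}).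
Local Open Scope group_scope.
Implicit Types (A : {set gT}) (g p m h b : gT).

Definition dcosets A : {set {set gT}} := [set L * [set g] * H | g in A].

Hypotheses (PG : P \subset G) (MP : M \subset P) (LM : L \subset M).
Hypotheses (nLP : P \subset 'N(L)) (BG : B \subset G).
Hypothesis BM : forall m b, m \in M -> b \in B -> m * b \in B.
Hypothesis BH : forall b h, b \in B -> h \in H -> b * h \in B.
Hypothesis PB : forall g, g \in G -> exists2 p, p \in P & p^-1 * g \in B.
Hypothesis BP : forall p b, p \in P -> b \in B -> p * b \in B -> p \in M.

Lemma dcoset_refl g : g \in L * [set g] * H.
Proof. by rewrite -[X in X \in _]mulg1 -[X in X * 1]mul1g !mem_mulg ?set11 ?group1. Qed.

Lemma dcoset_translate p g : p \in P ->
  L * [set p * g] * H = p *: (L * [set g] * H).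
Proof.
move=> /(subsetP nLP) nLp.
by rewrite -mulg_set1 [L * _]mulgA (norm_rlcoset nLp) -!mulgA.
Qed.

Lemma dcoset_sub b : b \in B -> L * [set b] * H \subset B.
Proof.
move=> bB; apply/subsetP => _ /mulsgP[_ h /mulsgP[l _ lL /set1P-> ->] hH ->].
by rewrite BH // BM // (subsetP LM).
Qed.

(** [G] is the disjoint union of the translates [t *: B], with [t] in a transversal of the
left cosets of [M] in [P].  Since [t] normalizes [L], translation by [t] maps the double
cosets contained in [B] to those contained in [t *: B]. *)
Lemma card_dcosets_split : #|dcosets G| = (#|P : M| * #|dcosets B|)%N.
Proof.
rewrite -card_lcosets -cardsX.
pose f (X : {set gT} * {set gT}) := fingroup.repr X.1 *: X.2.
have repP C : C \in lcosets M P -> fingroup.repr C \in P /\ C = fingroup.repr C *: M.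
  case/lcosetsP => p pP ->; have : fingroup.repr (p *: M) \in p *: M.
    exact: mem_repr (lcoset_refl M p).
  move=> h; split; last by apply/esym/lcoset_eqP.
  by case/lcosetP: h => m mM ->; rewrite groupM // (subsetP MP).
suff -> : dcosets G = f @: setX (lcosets M P) (dcosets B).
  apply: card_in_imset => -[C D] [C' D'] /setXP[/= CP DB] /setXP[/= CP' DB'].
  have [[tP eC] [tP' eC']] := (repP _ CP, repP _ CP').
  rewrite /f /=; move: DB DB' => /imsetP[b bB ->] /imsetP[b' bB' ->] eD.
  have : fingroup.repr C * b \in fingroup.repr C *: (L * [set b] * H).
    by rewrite mem_mulg ?set11 ?dcoset_refl.
  rewrite eD => /lcosetP[d /(subsetP (dcoset_sub bB')) dB tbd].
  have CC : C = C'.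
    rewrite eC eC'; apply/lcoset_eqP; rewrite mem_lcoset.
    apply: (BP _ bB); first by rewrite groupM ?groupV.
    by rewrite -mulgA tbd mulKg.
  move: eD; rewrite -CC => /(congr1 (fun X => (fingroup.repr C)^-1 *: X)).
  by rewrite !lcosetK => ->.
apply/setP => D; apply/imsetP/imsetP => [[g gG ->]|[[C D']]].
  have [p pP pg] := PB gG.
  have CP : p *: M \in lcosets M P by apply/lcosetsP; exists p.
  have [tP eC] := repP _ CP.
  have : p \in fingroup.repr (p *: M) *: M by rewrite -eC lcoset_refl.
  set t := fingroup.repr _ in tP eC *; case/lcosetP => m mM ptm.
  exists (p *: M, L * [set t^-1 * g] * H).
    rewrite in_setX CP; apply/imsetP; exists (t^-1 * g) => //.
    have -> : t^-1 * g = m * (p^-1 * g) by rewrite ptm invMg !mulgA mulgV mul1g.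
    exact: BM.
  by rewrite /f /= -/t -dcoset_translate // mulKVg.
case/setXP => /= /repP[tP _] /imsetP[b bB ->] ->.
exists (fingroup.repr C * b); last by rewrite dcoset_translate.
by rewrite groupM ?(subsetP PG _ tP) ?(subsetP BG _ bB).
Qed.
End DoubleCosetCount.

(** * Column echelon form *)

Lemma increasing_id s (f : nat -> nat) :
  (forall k, (k < s)%N -> (f k < s)%N) ->
  (forall k l, (k < l < s)%N -> (f k < f l)%N) ->
  forall k, (k < s)%N -> f k = k.
Proof.
move=> fs fi.
have ge k : (k < s)%N -> (k <= f k)%N.
  elim: k => // k IH ks; apply: leq_ltn_trans (IH (ltnW ks)) _.
  by apply: fi; rewrite ltnSn.
have le j k : (k + j < s)%N -> (f k + j < s)%N.
  elim: j k => [|j IH] k; first by rewrite !addn0; apply: fs.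
  rewrite addnS -addSn => ks; have kS : (k.+1 < s)%N by apply: leq_ltn_trans ks; rewrite leq_addr.
  have := IH _ ks; apply: leq_ltn_trans; rewrite addnS -addSn leq_add2r.
  by apply: fi; rewrite ltnSn.
move=> k ks; apply/anti_leq; rewrite ge // andbT.
have ek : (k + (s - k.+1)).+1 = s by rewrite -addSn subnKC.
by have := le (s - k.+1)%N k; rewrite -{2 4}ek ltnSn ltnS leq_add2r; apply.
Qed.

Section Echelon.
Variables (F : finFieldType) (V : vectType F) (r : nat) (e : r.-tuple V).
Hypothesis basis_e : basis_of {:V} e.
Local Notation fV := (finvect_type V).
Implicit Types (g h : {perm fV}) (i j k l : 'I_r) (s : nat) (v w : V).

(** The first [s] columns of the matrix of [g] are in echelon form, without the condition
that the rows of the leading entries vanish outside them. *)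
Definition echelon s : {set {perm fV}} :=
  [set g in autV V |
    [forall k : 'I_r, (k < s)%N ==> [exists i, monic_at e i (g e`_k)]] &&
    [forall k : 'I_r, forall l : 'I_r,
       (k < l < s)%N ==> (level e (g e`_k)%R < level e (g e`_l)%R)%N]].

Lemma echelonP s g : reflect
  [/\ g \in autV V, forall k, (k < s)%N -> exists i, monic_at e i (g e`_k) &
      forall k l, (k < l < s)%N -> (level e (g e`_k)%R < level e (g e`_l)%R)%N]
  (g \in echelon s).
Proof.
rewrite [X in reflect _ X]in_set; apply: (iffP and3P) => -[-> h1 h2]; split=> //.
- by move=> k ks; apply/existsP; move/forallP/(_ k)/implyP: h1; apply.
- by move=> k l kl; move/forallP/(_ k)/forallP/(_ l)/implyP: h2; apply.
- by apply/forallP => k; apply/implyP => /h1/existsP.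
by apply/forallP => k; apply/forallP => l; apply/implyP => /h2.
Qed.

Lemma monic_e i : monic_at e i e`_i.
Proof. by rewrite /monic_at subrr mem0v. Qed.

Lemma levelZ (a : F) v : a != 0 -> level e (a *: v) = level e v.
Proof.
by move=> a0; apply: eq_bigl => i; rewrite linearZ /= mulf_eq0 (negPf a0).
Qed.

Lemma echelon_flag s g k i v : g \in echelon s -> (k < s)%N ->
  monic_at e i (g e`_k) -> v \in flag e k -> (g v : V) \in flag e i.
Proof.
move=> /echelonP[autg mon inc] ks gi; apply: aut_flag => // l lk.
rewrite -level_le // -ltnS -(monic_level basis_e gi); apply: inc.
by rewrite lk.
Qed.

Lemma echelon_monic s g k i v : g \in echelon s -> (k < s)%N ->
  monic_at e i (g e`_k) -> monic_at e k v -> monic_at e i (g v).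
Proof.
move=> ge ks gi vk; have /echelonP[autg _ _] := ge; rewrite /monic_at.
have -> : (g v : V) - e`_i = g (v - e`_k : V) + ((g e`_k : V) - e`_i).
  by rewrite autB // addrA subrK.
by apply: memvD => //; apply: echelon_flag ge ks gi vk.
Qed.

Lemma echelon_mull s m g : (s <= r)%N ->
  m \in unitri e s -> g \in echelon s -> (m * g)%g \in echelon s.
Proof.
move=> sr /unitriP[autm mP] ge; have /echelonP[autg mon inc] := ge.
have mgm k : (k < s)%N -> exists2 i, monic_at e i (g e`_k) & monic_at e i ((m * g)%g e`_k).
  move=> ks; have [i gi] := mon k ks; exists i => //.
  by rewrite permM; apply: echelon_monic ge ks gi (mP k ks).
apply/echelonP; split=> [|k ks|k l /andP[kl ls]]; first exact: groupM.
  by have [i _ ?] := mgm k ks; exists i.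
have [i gi mi] := mgm k (ltn_trans kl ls); have [j gj mj] := mgm l ls.
have := inc k l; rewrite kl ls => /(_ isT).
rewrite (monic_level basis_e gi) (monic_level basis_e gj).
by rewrite (monic_level basis_e mi) (monic_level basis_e mj).
Qed.

Lemma echelon_mulr s g h : g \in echelon s -> h \in unitri e r ->
  (g * h)%g \in echelon s.
Proof.
move=> /echelonP[autg mon inc] hr; have /unitriP[auth _] := hr.
have hmon i v : monic_at e i v -> monic_at e i (h v).
  exact: unitri_monic hr (ltn_ord i).
apply/echelonP; split=> [|k ks|k l /andP[kl ls]]; first exact: groupM.
  by have [i /hmon gi] := mon k ks; exists i; rewrite permM.
have := inc k l; rewrite kl ls => /(_ isT); rewrite !permM.
have [[i gi] [j gj]] := (mon k (ltn_trans kl ls), mon l ls).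
rewrite (monic_level basis_e gi) (monic_level basis_e gj).
by rewrite (monic_level basis_e (hmon _ _ gi)) (monic_level basis_e (hmon _ _ gj)).
Qed.

(** Write [l_j] for the level of [g e_j].  If [p e_k], for [k < s], has its leading
coordinate at [j], then [j < s] and [g (p e_k)] has level [l_j].  As [p * g] is in
echelon form these levels increase with [k], so [j] increases with [k], and an
increasing map from [{0, ..., s-1}] to itself is the identity.  The leading coordinate
of [p e_k] is that of [g (p e_k)], namely [1]. *)
Lemma echelon_rigid s p g : (s <= r)%N -> p \in parabolic e s ->
  g \in echelon s -> (p * g)%g \in echelon s -> p \in unitri e s.
Proof.
move=> sr pP ge; have /echelonP[autg mon inc] := ge.
have [autp pflag] := parabolicP basis_e _ _ pP; move=> /echelonP[_ monp incp].
have lead k : (k < s)%N -> exists j, [/\ (j < s)%N, monic_at e j (p e`_k) &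
    level e ((p * g)%g e`_k) = level e (g e`_j)].
  move=> ks; have p0 : (p e`_k : V) != 0.
    apply: contraNneq (monic_neq0 basis_e (monic_e k)) => pk0.
    by apply/eqP/(@perm_inj _ p); rewrite pk0 aut0.
  have [j [lj cj mj]] := monic_normalize basis_e p0.
  have js : (j < s)%N by rewrite -lj level_le // pflag.
  have [i gi] := mon j js; have [i' gi'] := monp k ks.
  set c := coord e j (p e`_k) in cj mj.
  have := echelon_monic ge js gi mj; rewrite autZ // -permM => gim.
  have ii : i' = i.
    apply: val_inj; apply: succn_inj; rewrite -(monic_level basis_e gi').
    by rewrite -(monic_level basis_e gim) levelZ // invr_eq0.
  have c1 : c = 1.
    have := monic_coord basis_e gim; rewrite linearZ /= -ii.
    by rewrite (monic_coord basis_e gi') mulr1 => /(canRL invrK) ->; rewrite invr1.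
  exists j; split=> //; first by move: mj; rewrite c1 invr1 scale1r.
  by rewrite (monic_level basis_e gi') ii (monic_level basis_e gi).
apply/unitriP; split=> // k ks.
have [j [js pj _]] := lead k ks; suff /val_inj jk : j = k :> nat by rewrite -{1}jk.
pose f (n : nat) := (level e (p e`_n)).-1.
have -> : j = f k :> nat by rewrite /f (monic_level basis_e pj).
apply: (@increasing_id s f _ _ k ks) => [n ns|n m /andP[nm ms]].
  have [j' [j's pj' _]] := lead (Ordinal (leq_trans ns sr)) ns.
  by rewrite /f (monic_level basis_e pj').
have ns := ltn_trans nm ms.
have [jn [jns pjn levn]] := lead (Ordinal (leq_trans ns sr)) ns.
have [jm [jms pjm levm]] := lead (Ordinal (leq_trans ms sr)) ms.
rewrite /f (monic_level basis_e pjn) (monic_level basis_e pjm) /=.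
have := incp (Ordinal (leq_trans ns sr)) (Ordinal (leq_trans ms sr)).
rewrite /= nm ms => /(_ isT); rewrite levn levm => lt.
rewrite ltnNge leq_eqVlt; apply/negP => /predU1P[/val_inj jj|mn].
  by rewrite jj ltnn in lt.
by have := inc jm jn; rewrite mn jns ltnNge (ltnW lt) => /(_ isT).
Qed.

Lemma sorted_enum_ord (J : {set 'I_r}) : sorted (fun i j : 'I_r => i < j)%N (enum J).
Proof.
apply: sorted_filter; first by move=> j i k; apply: ltn_trans.
by have := iota_ltn_sorted 0 r; rewrite -val_enum_ord sorted_map enumT.
Qed.

(** A basis of vectors monic at all indices is rearranged so that the vectors with index in
[J] come first, in increasing order. *)
Lemma echelon_arrange (c : 'I_r -> V) (J : {set 'I_r}) :
  (forall i, monic_at e i (c i)) ->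
  exists g, [/\ g \in echelon #|J|,
    forall k, (k < #|J|)%N -> exists2 i, i \in J & g e`_k = c i &
    forall i, i \in J -> exists2 k : 'I_r, (k < #|J|)%N & g e`_k = c i].
Proof.
move=> cm; pose t := enum J ++ enum (~: J).
have t_size : size t = r by rewrite size_cat -!cardE cardsC card_ord.
have t_uniq : uniq t.
  rewrite cat_uniq !enum_uniq andbT /= -all_predC; apply/allP => i.
  by rewrite /= !mem_enum inE.
have sinj : injective (fun k : 'I_r => nth k t k).
  move=> k l; rewrite (set_nth_default k l) ?t_size // => /eqP.
  by rewrite nth_uniq ?t_size // => /eqP/val_inj.
pose p : {perm 'I_r} := perm sinj.
have [g autg gE] : exists2 g, g \in autV V & forall k, g e`_k = c (p k).
  apply: (aut_of_free basis_e) => a sum0 k.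
  rewrite -[k](permK p).
  apply: (@monic_family_free _ _ _ _ basis_e c (fun i => a ((p^-1)%g i)) cm).
  rewrite (reindex_inj (@perm_inj _ p)) -[RHS]sum0.
  by apply: eq_bigr => i _; rewrite permK.
have pJ k : (k < #|J|)%N -> p k = nth k (enum J) k.
  by move=> kJ; rewrite permE nth_cat -cardE kJ.
exists g; split.
- apply/echelonP; split=> // [k _|k l /andP[kl lJ]].
    by exists (p k); rewrite gE.
  rewrite !gE !(monic_level basis_e (cm _)) ltnS pJ ?(ltn_trans kl) // pJ //.
  rewrite (set_nth_default k l) -?cardE //.
  apply: (sorted_ltn_nth _ k (sorted_enum_ord J)) => //.
  - by move=> j i m; apply: ltn_trans.
  - by rewrite inE -cardE (ltn_trans kl).
  - by rewrite inE -cardE.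
- by move=> k kJ; exists (p k); rewrite ?gE // pJ // -mem_enum mem_nth // -cardE.
move=> i iJ; pose k := (p^-1)%g i.
exists k; last by rewrite gE permKV.
have : p k = i by rewrite permKV.
rewrite permE nth_cat -cardE; case: ltnP => // Jk ki.
have : i \in enum (~: J).
  rewrite -ki mem_nth // -cardE -(ltn_add2r #|J|) subnK // addnC cardsC card_ord.
  exact: ltn_ord.
by rewrite mem_enum inE iJ.
Qed.

(** An injective map cannot send a finite set into a strictly smaller one. *)
Lemma flag_inj_leq g (k l : nat) : (k <= r)%N ->
  (forall v, v \in flag e k -> (g v : V) \in flag e l) -> (k <= l)%N.
Proof.
move=> kr h; rewrite leqNgt; apply/negP => lk.
pose A m := [set v : fV | (v : V) \in flag e m].
have : (#|A k| <= #|A l|)%N.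
  rewrite -(card_imset _ (@perm_inj _ g)); apply/subset_leq_card/subsetP => w.
  by case/imsetP => v; rewrite !inE => /h gv ->.
rewrite leqNgt => /negP; apply; apply/proper_card/properP; split.
  by apply/subsetP => v; rewrite !inE; apply: flagS => //; apply: ltnW.
exists (e`_l : V); first by rewrite inE (mem_flag_e basis_e (Ordinal (leq_trans lk kr))).
by rewrite inE (mem_flag_e basis_e (Ordinal (leq_trans lk kr))) ltnn.
Qed.

(** Gaussian elimination.  Let [W] be the image of the span of the first [s] basis vectors,
and [J] the set of leading indices of its nonzero elements.  Choose [c i] in [W] monic
at [i] for each [i] in [J]; reducing leading coordinates shows that these vectors span
[W], and they are the first [#|J|] columns of an echelon automorphism [b].  Then
[g * b^-1] and its inverse exchange the flag subspaces of dimensions [s] and [#|J|], so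
that [s = #|J|] and [g * b^-1] is in [parabolic e s]. *)
Lemma echelon_exists s g : (s <= r)%N -> g \in autV V ->
  exists2 p, p \in parabolic e s & (p^-1 * g)%g \in echelon s.
Proof.
move=> sr autg; pose W (v : V) := (g^-1%g v : V) \in flag e s.
have WB v w (a : F) : W v -> W w -> W (v - a *: w).
  by move=> Wv Ww; rewrite /W autB ?groupV // autZ ?groupV // memvB ?memvZ.
pose c i : V := odflt (e`_i : V) [pick v : fV | monic_at e i v && W v].
pose J := [set i | [exists v : fV, monic_at e i v && W v]].
have cm i : monic_at e i (c i).
  by rewrite /c; case: pickP => [v /andP[] //|_]; apply: monic_e.
have cW i : i \in J -> W (c i).
  by rewrite inE /c => /existsP[v0 v0P]; case: pickP => [v /andP[] //|/(_ v0)]; rewrite v0P.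
have [b [be bJ Jb]] := echelon_arrange J cm.
have /echelonP[autb _ _] := be.
have Jr : (#|J| <= r)%N by rewrite -[r in X in (_ <= X)%N]card_ord max_card.
(* [W] contains the first [#|J|] columns of [b], which are linearly independent *)
have Js : (#|J| <= s)%N.
  apply: (@flag_inj_leq (b * g^-1)%g) => // v vJ.
  apply: aut_flag vJ; rewrite ?groupM ?groupV // => k kJ.
  by rewrite permM; have [i /cW Wi ->] := bJ k kJ.
have bW v : W v -> (b^-1%g v : V) \in flag e #|J|.
  have [n] := ubnP (level e v); elim: n => // n IH in v *.
  rewrite ltnS => vn Wv; have [->|v0] := eqVneq v 0.
    by rewrite aut0 ?groupV // mem0v.
  have [i [lv cv mv]] := monic_normalize basis_e v0.
  have iJ : i \in J.
    rewrite inE; apply/existsP; exists ((coord e i v)^-1 *: v : V).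
    by rewrite mv /= /W autZ ?groupV // memvZ.
  have -> : v = coord e i v *: c i + (v - coord e i v *: c i) by rewrite addrC subrK.
  rewrite autD ?groupV // autZ ?groupV //; apply: memvD.
    have [k kJ bk] := Jb i iJ; rewrite memvZ // -bk permK.
    by rewrite mem_flag_e.
  apply: IH; last by apply: WB => //; apply: cW.
  apply: leq_trans vn; rewrite lv ltnS.
  rewrite -(levelZ _ (_ : (coord e i v)^-1 != 0)) ?invr_eq0 //.
  by rewrite scalerBr scalerK //; apply: level_monicB.
have sJ : s = #|J|.
  apply/anti_leq; rewrite Js andbT; apply: (@flag_inj_leq (g * b^-1)%g) => // v vs.
  by rewrite permM; apply: bW; rewrite /W permK.
exists (g * b^-1)%g; last by rewrite invMg invgK mulgKV sJ.
apply/parabolicP => //; split=> [|j js]; first by rewrite groupM ?groupV.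
by rewrite permM sJ; apply: bW; rewrite /W permK mem_flag_e.
Qed.

End Echelon.

(** * Echelon automorphisms and configurations *)

Lemma leq_card_imset_fibers (T A B : finType) (S : {set T}) (f : T -> A) (g : T -> B) :
  {in S &, forall x y, f x = f y -> g x = g y} -> (#|g @: S| <= #|f @: S|)%N.
Proof.
move=> fg; pose h z := if [pick x in S | f x == z] is Some x then Some (g x) else None.
rewrite -(card_imset _ (@Some_inj _)).
apply: leq_trans (leq_imset_card h _); apply/subset_leq_card/subsetP => z.
case/imsetP=> y0 /imsetP[x xS ->] ->; apply/imsetP.
exists (f x); first exact: imset_f.
rewrite /h; case: pickP => [y /andP[yS /eqP yx]|/(_ x)]; last by rewrite xS eqxx.
by rewrite (fg y x).
Qed.

Section Configurations.
Variables (F : finFieldType) (V : vectType F) (r : nat) (e : r.-tuple V).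
Hypothesis basis_e : basis_of {:V} e.
Local Notation fV := (finvect_type V).
Implicit Types (g h : {perm fV}) (i j k l : 'I_r) (s : nat).

Definition config_move (c : {ffun 'I_r -> fV}) (h : {perm fV}) :
  {ffun 'I_r -> fV} := [ffun i => h (c i)].

Fact config_move_is_action : is_action [set: {perm fV}] config_move.
Proof.
by apply: is_total_action => [c|c g h]; apply/ffunP => i; rewrite !ffunE ?perm1 ?permM.
Qed.
Definition config_action := Action config_move_is_action.

(** For [g] in echelon form at most one of the first [s] columns is monic at [i], and the
sum selects it. *)
Definition config_of s g : {ffun 'I_r -> fV} :=
  [ffun i => \sum_(k < r | (k < s)%N && monic_at e i (g e`_k)) (g e`_k : V)].

Lemma config_of_monic s g k i : g \in echelon e s -> (k < s)%N ->
  monic_at e i (g e`_k) -> config_of s g i = g e`_k.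
Proof.
move=> /echelonP[_ _ inc] ks gi; rewrite ffunE (big_pred1 k) // => l /=.
apply/andP/eqP => [[ls li]|->//]; apply/val_inj/eqP.
have eq : level e (g e`_l) = level e (g e`_k).
  by rewrite (monic_level basis_e gi) (monic_level basis_e li).
by case: ltngtP => // lk; [have := inc l k | have := inc k l];
  rewrite lk ?ks ?ls eq ltnn => /(_ isT).
Qed.

Lemma config_ofP s g i : g \in echelon e s ->
  (exists2 k : 'I_r, (k < s)%N & monic_at e i (g e`_k) /\ config_of s g i = g e`_k) \/
  config_of s g i = 0.
Proof.
move=> ge; have [/existsP[k /andP[ks gi]]|] :=
  boolP [exists k : 'I_r, (k < s)%N && monic_at e i (g e`_k)].
  by left; exists k; rewrite ?(config_of_monic ge ks gi).
rewrite negb_exists => /forallP h; right; rewrite ffunE big1 // => k.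
by rewrite (negPf (h k)).
Qed.

Lemma config_of_configs s g : g \in echelon e s -> config_of s g \in configs e.
Proof.
move=> ge; apply/configsP => i.
by case: (config_ofP i ge) => [[k ks [gi ->]]|]; auto.
Qed.

Lemma card_vsupp_config_of s g : (s <= r)%N ->
  g \in echelon e s -> #|vsupp (config_of s g)| = s.
Proof.
move=> sr ge; have /echelonP[_ mon inc] := ge.
pose w (k : 'I_s) := widen_ord sr k.
have /fin_all_exists[ell ellP] (k : 'I_s) : exists i, monic_at e i (g e`_(w k)).
  exact: (mon (w k) (ltn_ord k)).
have -> : vsupp (config_of s g) = ell @: [set: 'I_s].
  apply/setP => i; rewrite inE; apply/idP/imsetP => [ci|[k _ ->]]; last first.
    rewrite (config_of_monic (k := w k) ge (ltn_ord k) (ellP k)).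
    exact: (monic_neq0 basis_e (ellP k)).
  case: (config_ofP i ge) => [[k ks [gi _]]|c0]; last by rewrite c0 eqxx in ci.
  exists (Ordinal ks) => //; apply: (monic_inj basis_e gi).
  exact: (ellP (Ordinal ks)).
rewrite card_imset ?cardsT ?card_ord // => k l kl.
have eq : level e (g e`_(w k)) = level e (g e`_(w l)).
  by rewrite !(monic_level basis_e (ellP _)) kl.
apply/val_inj/eqP; case: ltngtP => // lt;
  [have := inc (w k) (w l) | have := inc (w l) (w k)];
  by rewrite /= lt ltn_ord eq ltnn => /(_ isT).
Qed.

Lemma config_of_mull s h g : h \in parabolicL e s ->
  config_of s (h * g)%g = config_of s g.
Proof.
move=> /(parabolicLP basis_e)[_ hE]; apply/ffunP => i; rewrite !ffunE.
by apply: eq_big => k => [|/andP[ks _]]; rewrite permM; 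
  [case: ltnP => // ks; rewrite hE | rewrite hE].
Qed.

Lemma config_of_mulr s g h : h \in unitri e r ->
  config_of s (g * h)%g = config_move (config_of s g) h.
Proof.
move=> hr; have /unitriP[auth _] := hr; apply/ffunP => i; rewrite !ffunE.
rewrite -[RHS]/(autFun auth _) linear_sum; apply: eq_big => k => [|_].
  rewrite permM; congr (_ && _); apply/idP/idP; last first.
    exact: unitri_monic hr (ltn_ord i).
  have hVr : (h^-1)%g \in unitri_group basis_e r by rewrite groupV.
  by move=> /(unitri_monic basis_e hVr (ltn_ord i)); rewrite permK.
exact: permM.
Qed.

(** If both configurations agree, the columns of [g'] are columns of [g] up to order, so
that [g' * g^-1] permutes the first [s] basis vectors; as it is unitriangular on them
by [echelon_rigid], it fixes them. *)
Lemma config_of_inj s g g' : (s <= r)%N -> g \in echelon e s ->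
  g' \in echelon e s -> config_of s g = config_of s g' ->
  (g' * g^-1)%g \in parabolicL e s.
Proof.
move=> sr ge ge' eqc; have [/echelonP[autg _ _] /echelonP[autg' mon' _]] := (ge, ge').
have pE k : (k < s)%N -> exists2 l : 'I_r, (l < s)%N & (g' * g^-1)%g e`_k = e`_l :> V.
  move=> ks; have [i gi'] := mon' k ks.
  have := config_of_monic ge' ks gi'; rewrite -eqc => ci.
  case: (config_ofP i ge) => [[l ls [_ cl]]|c0].
    by exists l => //; rewrite permM -ci cl permK.
  by have := monic_neq0 basis_e gi'; rewrite -ci c0 eqxx.
have pP : (g' * g^-1)%g \in parabolic e s.
  apply/parabolicP => //; split=> [|k ks]; first by rewrite groupM ?groupV.
  by have [l ls ->] := pE k ks; rewrite mem_flag_e.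
have /unitriP[autp pM] : (g' * g^-1)%g \in unitri e s.
  by apply: (echelon_rigid basis_e sr pP ge); rewrite mulgKV.
apply/parabolicLP => //; split=> // k ks; have [l ls pl] := pE k ks.
have := pM k ks; rewrite pl => kl; congr (_`_ _).
by rewrite (monic_inj basis_e kl (monic_e _ l)).
Qed.

(** Completing [c] by the vectors [e_i] at the indices outside its support gives a basis to
which [echelon_arrange] applies. *)
Lemma config_of_onto (c : {ffun 'I_r -> fV}) : c \in configs e ->
  exists2 g, g \in echelon e #|vsupp c| & config_of #|vsupp c| g = c.
Proof.
move=> /configsP cc; pose c' i : V := if c i == 0 then e`_i else c i.
have c'm i : monic_at e i (c' i).
  rewrite /c'; case: eqP => [_|c0]; first exact: monic_e.
  by case: (cc i).
have [g [ge gJ Jg]] := echelon_arrange basis_e (vsupp c) c'm.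
exists g => //; apply/ffunP => i; have [iJ|iJ] := boolP (i \in vsupp c).
  have [k ks gk] := Jg i iJ; rewrite (config_of_monic ge ks); last by rewrite gk.
  by rewrite gk /c'; move: iJ; rewrite inE => /negPf->.
have -> : c i = 0 by move: iJ; rewrite inE negbK => /eqP.
case: (config_ofP i ge) => // -[k ks [gi _]].
have [j jJ gk] := gJ k ks; rewrite gk in gi.
by move: iJ; rewrite (monic_inj basis_e gi (c'm j)) jJ.
Qed.

(** The map [config_of s] is onto the configurations with support of size [s], its fibers
are the cosets of [L_s], and it is equivariant for [H]. *)
Lemma card_dcosets_echelon (H : {group {perm fV}}) s : (s <= r)%N ->
  H \subset unitri e r ->
  #|dcosets (parabolicL_group basis_e s) H (echelon e s)| =
  #|orbit config_action H @: [set c in configs e | #|vsupp c| == s]|.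
Proof.
move=> sr HU; set C := [set c in _ | _].
have -> : C = config_of s @: echelon e s.
  apply/setP => c; rewrite inE; apply/andP/imsetP => [[cc /eqP cs]|[g ge ->]].
    by have [g ge <-] := config_of_onto cc; rewrite cs in ge *; exists g.
  by rewrite config_of_configs // card_vsupp_config_of.
rewrite -imset_comp.
apply/anti_leq/andP; split; apply: leq_card_imset_fibers => g g' ge ge' /=.
  move=> /orbit_eqP/orbitP[h hH]; have hU := subsetP HU h hH.
  rewrite /= -config_of_mulr // => /(config_of_inj sr (echelon_mulr basis_e ge' hU) ge) lL.
  rewrite -[g](mulgKV (g' * h)%g); set l := (_ * _)%g in lL *.
  rewrite -mulg_set1 mulgA (rcoset_id lL) -mulg_set1 -!mulgA.
  by rewrite (lcoset_id hH).
move=> eD; have : g \in (parabolicL e s * [set g'] * H)%g.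
  by rewrite -eD; apply: (@dcoset_refl _ (parabolicL_group basis_e s)).
case/mulsgP=> _ h /mulsgP[l _ lL /set1P-> ->] hH ->.
apply/orbit_eqP; rewrite config_of_mulr ?(subsetP HU) // config_of_mull //.
exact: (mem_orbit config_action).
Qed.
End Configurations.

(** * Counting compositions *)

Section Compositions.
Variables (r n : nat).
Implicit Types (m : {ffun 'I_r -> 'I_n.+1}) (J : {set 'I_r}).

Definition compositions J : {set {ffun 'I_r -> 'I_n.+1}} :=
  [set m : {ffun 'I_r -> 'I_n.+1} |
    ([set i | m i != 0 :> nat] == J) && (\sum_i m i == n)%N].

Let P : {poly rat} := \sum_(j < n.+1 | j != 0 :> nat) 'X^j.

(** Each index in [J] contributes a factor [P = 'X + ... + 'X^n] to the generating
function. *)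
Lemma card_compositions_coef J : #|compositions J|%:R = (P ^+ #|J|)`_n.
Proof.
pose T i (j : 'I_n.+1) : {poly rat} :=
  if (i \in J) == (j != 0 :> nat) then 'X^j else 0.
have -> : P ^+ #|J| = \prod_i \sum_j T i j.
  rewrite -prodr_const big_mkcond /=; apply: eq_bigr => i _.
  rewrite /T /P; case: (i \in J); first by rewrite big_mkcond; apply: eq_bigr.
  by rewrite (bigD1 ord0) //= big1 ?addr0 // => j; rewrite -val_eqE /= => /negPf->.
rewrite bigA_distr_bigA /= coef_sum -sum1_card natr_sum big_mkcond /=.
apply: eq_bigr => m _; rewrite inE.
have [/forallP mJ|] := boolP [forall i, (i \in J) == (m i != 0 :> nat)].
  have -> : [set i | m i != 0 :> nat] = J.
    by apply/setP => i; rewrite inE (eqP (mJ i)).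
  rewrite eqxx (eq_bigr (fun i => 'X^(m i))) => [|i _]; last by rewrite /T mJ.
  by rewrite prodrXr coefXn eq_sym; case: eqP.
rewrite negb_forall => /existsP[i mi].
have T0 : T i (m i) = 0 by rewrite /T (negPf mi).
rewrite [\prod_i _](bigD1 i) //= T0 mul0r coef0; case: eqP => // mJ.
by move: mi; rewrite -mJ inE eqxx.
Qed.

Lemma coef_P k : (k <= n)%N -> P`_k = (k != 0)%:R.
Proof.
move=> kn; rewrite coef_sum.
have [->|k0] /= := eqVneq k 0%N.
  by rewrite big1 // => j j0; rewrite coefXn eq_sym (negPf j0).
rewrite (bigD1 (Ordinal (kn : (k < n.+1)%N))) //= coefXn eqxx big1 ?addr0 //.
by move=> j /andP[_]; rewrite -val_eqE /= => jk; rewrite coefXn eq_sym (negPf jk).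
Qed.

Lemma coef_P_exp_rec s k : (k <= n)%N ->
  (P ^+ s.+1)`_k = \sum_(l < k) (P ^+ s)`_l.
Proof.
move=> kn; rewrite exprSr coefM big_ord_recr /= subnn coef_P // mulr0 addr0.
apply: eq_bigr => l _; rewrite coef_P ?leq_subLR ?(leq_trans kn) ?leq_addl //.
by rewrite subn_eq0 leqNgt ltn_ord mulr1.
Qed.

(** By [coef_P_exp_rec] this is the hockey-stick identity. *)
Lemma coef_P_exp s k : (k < n)%N -> (P ^+ s.+1)`_k.+1 = 'C(k, s)%:R.
Proof.
elim: s k => [|s IH] k kn; rewrite coef_P_exp_rec //.
  rewrite big_ord_recl /= coef1 big1 ?addr0 ?bin0 // => l _.
  by rewrite coef1.
rewrite big_ord_recl /= coef_P_exp_rec // big_ord0 add0r.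
elim: k kn => [|k IHk] kn; first by rewrite big_ord0.
by rewrite big_ord_recr /= IHk ?(ltnW kn) // IH ?(ltnW kn) // binS natrD.
Qed.

Lemma card_compositions J : #|compositions J|%:R =
  if J == set0 then (n == 0)%:R
  else if n is k.+1 then 'C(k, #|J|.-1)%:R else 0 :> rat.
Proof.
rewrite card_compositions_coef -cards_eq0.
case: #|J| => [|s] /=; first by rewrite expr0 coef1.
case: (n) coef_P_exp coef_P_exp_rec => [_ -> //|k -> //]; by rewrite ?big_ord0.
Qed.
End Compositions.

Lemma binz_nat (m k : nat) : binz m%:Z k = 'C(m, k)%:R.
Proof.
rewrite /binz; have -> : \prod_(i < k) (m%:Z - i%:Z) = (m ^_ k)%:Z.
  elim: k => [|k IH]; first by rewrite big_ord0.
  rewrite big_ord_recr IH ffactnSr /=; have [km|mk] := leqP k m.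
    by rewrite subzn.
  by rewrite ffact_small ?mul0r ?mul0n.
rewrite -bin_ffact PoszM rmorphM /= mulfK //.
by rewrite Num.Theory.pnatr_eq0 -lt0n fact_gt0.
Qed.

Lemma binzN1 k : binz (-1) k = (-1) ^+ k.
Proof.
rewrite /binz; have -> : \prod_(i < k) (-1 - i%:Z) = (-1) ^+ k * (k`!)%:Z.
  elim: k => [|k IH]; first by rewrite big_ord0.
  rewrite big_ord_recr IH /= factS PoszM exprSr.
  rewrite -[LHS]mulrA [_%:Z * (_ - _)]mulrC -!mulrA; congr (_ * _).
  rewrite mulrA; congr (_ * _).
  by rewrite mulN1r -opprD -add1n PoszD.
rewrite rmorphM rmorphXn rmorphN1 /= mulfK //.
by rewrite Num.Theory.pnatr_eq0 -lt0n fact_gt0.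
Qed.

(** * Subgroups of the unitriangular group *)

Section FlagCase.
Variables (F : finFieldType) (V : vectType F) (r : nat) (e : r.-tuple V).
Hypothesis basis_e : basis_of {:V} e.
Local Notation fV := (finvect_type V).
Local Notation index N := ({ffun 'I_r -> fV} * {ffun 'I_r -> 'I_N.+1})%type.
Variable H : {group {perm fV}}.
Hypothesis HU : H \subset unitri e r.
Implicit Types (g h : {perm fV}) (i j k l : 'I_r) (s n : nat) (J : {set 'I_r}).
Implicit Types (c : {ffun 'I_r -> fV}).

Definition index_move n (x : index n) (h : {perm fV}) : index n :=
  (config_move x.1 h, x.2).

Fact index_move_is_action n : is_action [set: {perm fV}] (@index_move n).
Proof.
apply: is_total_action => [[c m]|[c m] g h]; congr (_, _); apply/ffunP => i;
  by rewrite !ffunE ?perm1 ?permM.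
Qed.
Definition index_action n := Action (@index_move_is_action n).

Lemma config_move_monic h c i : h \in unitri e r ->
  monic_at e i (config_move c h i) = monic_at e i (c i).
Proof.
move=> hr; rewrite ffunE; apply/idP/idP; last exact: unitri_monic hr (ltn_ord i).
have hVr : (h^-1)%g \in unitri_group basis_e r by rewrite groupV.
by move=> /(unitri_monic basis_e hVr (ltn_ord i)); rewrite permK.
Qed.

Lemma vsupp_move h c : h \in autV V -> vsupp (config_move c h) = vsupp c.
Proof.
move=> auth; apply/setP => i; rewrite !inE ffunE.
by rewrite -[in LHS](aut0 auth) (inj_eq perm_inj).
Qed.

Lemma configs_move h c : h \in unitri e r ->
  (config_move c h \in configs e) = (c \in configs e).
Proof.
move=> hr; have /unitriP[auth _] := hr.
rewrite !inE; apply: eq_forallb => i; rewrite config_move_monic //; congr (_ || _).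
have := congr1 (fun A : {set _} => i \notin A) (vsupp_move c auth).
by rewrite !inE !negbK.
Qed.

Lemma configs_acts s :
  [acts H, on [set c in configs e | #|vsupp c| == s] | (config_action V r)].
Proof.
apply/actsP => h hH c; have hr := subsetP HU h hH; have /unitriP[auth _] := hr.
by rewrite [LHS]in_set [RHS]in_set /= configs_move // vsupp_move.
Qed.

Lemma in_graded n (x : index n) : (x \in graded_monomials e n) =
  [&& x.1 \in configs e, vsupp x.1 == nsupp x.2 & (\sum_i x.2 i == n)%N].
Proof. by rewrite andbA [LHS]in_set; congr (_ && _); rewrite [LHS]in_set. Qed.

Lemma graded_acts n : [acts H, on graded_monomials e n | index_action n].
Proof.
apply/actsP => h hH [c m]; have hr := subsetP HU h hH; have /unitriP[auth _] := hr.
by rewrite !in_graded /= configs_move // vsupp_move.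
Qed.

Lemma fracMap_monomial n h (x : index n) (auth : h \in autV V) :
  fracAut auth (monomial x) = monomial (index_move x h).
Proof.
rewrite /monomial rmorph_prod /=; apply: eq_bigr => i _.
by rewrite rmorphXn /= fracAut_recip ffunE.
Qed.

(** The identity outside [autV V] is a default value: a total function is required. *)
Definition frac_act h : {linear symFrac V -> symFrac V} :=
  if decP (@idP (h \in autV V)) is left auth then fracAut auth else idfun.

Lemma frac_actE h x : h \in autV V -> frac_act h x = fracMap (h : V -> V) x.
Proof. by rewrite /frac_act; case: decP. Qed.

(** The standard monomials are a basis of the degree [-n] part that [H] permutes. *)
Lemma hasDim_invRV n :
  hasDim (@invRV F V H n) #|orbit (index_action n) H @: graded_monomials e n|.
Proof.
have autH h : h \in H -> h \in autV V by move/(subsetP HU)/unitriP => -[].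
apply: (@hasDim_iso _ _ _ idfun idfun _ _ _ _ _ _
  (@hasDim_orbits F (symFrac V) _ _ H (index_action n) (graded_monomials e n)
     (@monomial F V r n) frac_act (graded_acts n) _ _)) => //.
- move=> y; rewrite /invRV (RVdegP basis_e); split=> -[? inv]; split=> // h hH.
    by rewrite frac_actE ?inv ?autH.
  by rewrite -frac_actE ?inv ?autH.
- move=> h x hH _; have auth := autH h hH.
  by rewrite frac_actE // -[LHS]/(fracAut auth _) fracMap_monomial.
move=> a sum0 x xG; pose a' y := if y \in graded_monomials e n then a y else 0.
have := @monomial_free _ _ _ _ basis_e n a' _ x.
rewrite /a' xG; apply; last by move: xG; rewrite inE => /andP[].
rewrite -[RHS]sum0 big_mkcond [RHS]big_mkcond; apply: eq_bigr => y _.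
have [yG|_] := boolP (y \in graded_monomials e n); last by rewrite scale0r if_same.
by have := yG; rewrite inE => /andP[->].
Qed.

Definition fix_configs h J : {set {ffun 'I_r -> fV}} :=
  [set c in configs e | (vsupp c == J) && (config_move c h == c)].

Lemma card_fix_graded n h : #|'Fix_(graded_monomials e n | index_action n)[h]%g| =
  (\sum_J #|compositions n J| * #|fix_configs h J|)%N.
Proof.
rewrite -sum1_card (partition_big (fun x : index n => vsupp x.1) xpredT) //=.
apply: eq_bigr => J _; rewrite mulnC -cardsX -sum1_card; apply: eq_bigl => -[c m].
rewrite in_setI in_setX in_graded /=.
rewrite [c \in fix_configs _ _]in_set [m \in compositions _ _]in_set.
pose to := index_action n; have -> : ((c, m) \in 'Fix_to[h])%g = (config_move c h == c).
  by apply/afix1P/eqP => [[]|/= ch] //; rewrite /index_move /= ch.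
rewrite [nsupp m]/nsupp; have [<-|_] := eqVneq (vsupp c) J; last by rewrite !andbF.
by rewrite !andbT /= [vsupp c == _]eq_sym -!andbA; do !bool_congr.
Qed.

Lemma card_fix_configs s h :
  #|'Fix_([set c in configs e | #|vsupp c| == s] | (config_action V r))[h]%g| =
  (\sum_(J : {set 'I_r} | #|J| == s) #|fix_configs h J|)%N.
Proof.
rewrite -sum1_card (partition_big (@vsupp F V r) (fun J => #|J| == s)) /=; last first.
  by move=> c; rewrite in_setI in_set => /andP[/andP[]].
apply: eq_bigr => J /eqP Js; rewrite -sum1_card; apply: eq_bigl => c.
rewrite in_setI [c \in fix_configs _ _]in_set.
rewrite [X in X && _ && _]in_set.
pose to := config_action V r; have -> : (c \in 'Fix_to[h])%g = (config_move c h == c).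
  by apply/afix1P/eqP.
by have [->|_] := eqVneq (vsupp c) J; rewrite ?Js ?eqxx ?andbT ?andbF.
Qed.

(** Only [e_0] is monic at the index [0], and it is fixed by [h]; so it can be added to a
fixed configuration in exactly one way. *)
Lemma card_fix_configs_toggle h J i : h \in unitri e r -> i = 0%N :> nat ->
  i \notin J -> #|fix_configs h (i |: J)| = #|fix_configs h J|.
Proof.
move=> hr i0 iJ; pose f c : {ffun 'I_r -> fV} :=
  [ffun j => if j == i then (e`_i : V) else c j].
have supp0 c : vsupp c = J -> c i = 0.
  by move=> cJ; move: iJ; rewrite -cJ inE negbK => /eqP.
have fixE c K : c \in fix_configs h K =
    [&& c \in configs e, vsupp c == K & config_move c h == c] by rewrite in_set.
suff -> : fix_configs h (i |: J) = f @: fix_configs h J.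
  rewrite card_in_imset // => c c'; rewrite !fixE => /and3P[_ /eqP cJ _].
  move=> /and3P[_ /eqP cJ' _] /ffunP ff; apply/ffunP => j.
  have := ff j; rewrite !ffunE; case: eqP => // -> _.
  by rewrite !supp0.
have he : h (e`_i : V) = e`_i :> V.
  have /unitriP[_ /(_ i (ltn_ord i))] := hr.
  by rewrite /monic_at i0 flag0 subr_eq0 => /eqP.
apply/setP => c; apply/idP/imsetP => [|[c' + ->]]; rewrite fixE.
  move=> /and3P[/configsP cc /eqP cJ /eqP ch].
  pose c' : {ffun 'I_r -> fV} := [ffun j => if j == i then 0 else c j].
  have ci : c i = e`_i :> V.
    case: (cc i) => [ci0|]; last by rewrite /monic_at i0 flag0 subr_eq0 => /eqP.
    have : i \in vsupp c by rewrite cJ setU11.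
    by rewrite inE ci0 eqxx.
  exists c'; last first.
    by apply/ffunP => j; rewrite !ffunE; case: eqP => // ->.
  rewrite fixE; apply/and3P; split.
  - apply/configsP => j; rewrite ffunE; case: eqP => _; first by left.
    exact: cc.
  - apply/eqP/setP => j; rewrite inE ffunE; have [->|ji] := eqVneq j i.
      by rewrite eqxx (negPf iJ).
    have := congr1 (fun A : {set _} => j \in A) cJ.
    by rewrite inE in_setU1 (negPf ji).
  apply/eqP/ffunP => j; rewrite !ffunE; case: eqP => _.
    by have /unitriP[auth _] := hr; apply: aut0.
  by have /ffunP/(_ j) := ch; rewrite ffunE.
rewrite fixE => /and3P[/configsP cc /eqP cJ /eqP ch]; apply/and3P; split.
- apply/configsP => j; rewrite ffunE; case: eqP => [->|_]; last exact: cc.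
  by right; apply: monic_e.
- apply/eqP/setP => j; rewrite inE ffunE in_setU1; have [->|_] /= := eqVneq j i.
    exact: (monic_neq0 basis_e (monic_e e i)).
  by rewrite -cJ inE.
apply/eqP/ffunP => j; rewrite !ffunE; case: eqP => _; first exact: he.
by have /ffunP/(_ j) := ch; rewrite ffunE.
Qed.

Lemma alternating_fix_configs h : (0 < r)%N -> h \in unitri e r ->
  \sum_(J : {set 'I_r}) (-1) ^+ #|J| * #|fix_configs h J|%:R = 0 :> rat.
Proof.
move=> r0 hr; pose i := Ordinal r0.
rewrite (bigID (fun J : {set 'I_r} => i \in J)) /=.
rewrite (reindex_onto (fun J : {set 'I_r} => i |: J) (fun J => J :\ i)) => [|J iJ]; last first.
  exact: setD1K.
rewrite [X in X + _](eq_bigl (fun J : {set 'I_r} => i \notin J)) => [|J]; last first.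
  rewrite setU11 /=; apply/eqP/idP => [<-|iJ]; first by rewrite setD11.
  exact: setU1K.
rewrite -big_split big1 // => J iJ /=.
by rewrite cardsU1 iJ card_fix_configs_toggle // exprS mulN1r mulNr addNr.
Qed.

(** For [n > 0] both sides agree term by term.  For [n = 0] the left side is the term of the
empty configuration, and the right side is minus the alternating sum over the nonempty
ones. *)
Lemma fix_count_identity n h : (0 < r)%N -> h \in unitri e r ->
  (\sum_J #|compositions n J| * #|fix_configs h J|)%N%:R =
  \sum_(1 <= s < r.+1)
     (\sum_(J : {set 'I_r} | #|J| == s) #|fix_configs h J|)%N%:R
     * binz (n%:Z - 1) (s - 1) :> rat.
Proof.
move=> r0 hr; transitivity (\sum_(J : {set 'I_r} | J != set0)
    #|fix_configs h J|%:R * binz (n%:Z - 1) (#|J| - 1)); last first.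
  under [RHS]eq_bigr do rewrite natr_sum mulr_suml.
  rewrite (exchange_big_dep xpredT) //= big_mkcond /=; apply: eq_bigr => J _.
  under eq_bigl do rewrite eq_sym.
  rewrite big_nat1_eq card_gt0 ltnS.
  have -> : (#|J| <= r)%N by apply: leq_trans (max_card _) _; rewrite card_ord.
  by rewrite andbT.
rewrite natr_sum; case: n => [|n].
  have := alternating_fix_configs r0 hr.
  rewrite (bigD1 set0) //= [X in _ -> X = _](bigD1 set0) //=.
  rewrite cards0 mul1r natrM card_compositions eqxx mul1r => /(canRL (addrK _)) ->.
  rewrite sub0r [X in _ + X]big1 ?addr0 => [|J /negPf J0]; last first.
    by rewrite natrM card_compositions J0 mul0r.
  rewrite -sumrN; apply: eq_bigr => J; rewrite -cards_eq0 => J0.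
  rewrite sub0r binzN1 mulrC -mulrN; congr (_ * _).
  by case: #|J| J0 => // s _; rewrite subn1 exprS mulN1r opprK.
rewrite [RHS]big_mkcond /=; apply: eq_bigr => J _.
rewrite natrM card_compositions mulrC; case: eqP => _ /=; first by rewrite mulr0.
have -> : n.+1%:Z - 1 = n%:Z by rewrite -addn1 PoszD addrK.
by rewrite subn1 binz_nat.
Qed.

Lemma card_orbits_graded n : (0 < r)%N ->
  #|orbit (index_action n) H @: graded_monomials e n|%:R =
  \sum_(1 <= s < r.+1)
     #|orbit (config_action V r) H @: [set c in configs e | #|vsupp c| == s]|%:R
     * binz (n%:Z - 1) (s - 1) :> rat.
Proof.
move=> r0; have H0 : #|H|%:R != 0 :> rat.
  by rewrite Num.Theory.pnatr_eq0 -lt0n cardG_gt0.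
apply: (mulIf H0); rewrite -natrM -(Frobenius_Cauchy (graded_acts n)).
rewrite mulr_suml natr_sum.
under [RHS]eq_bigr do
  rewrite mulrAC -natrM -(Frobenius_Cauchy (configs_acts _)) natr_sum mulr_suml.
rewrite exchange_big; apply: eq_bigr => h hH /=.
rewrite card_fix_graded fix_count_identity ?(subsetP HU) //.
by apply: eq_bigr => s _; rewrite card_fix_configs.
Qed.

(** The automorphism group is split into translates of the set of echelon automorphisms,
indexed by the cosets of [U L_s] in [P_s]. *)
Lemma orbit_configs_dcosets s : (s <= r)%N ->
  #|doubleCosets H (autV V) (parabolicL e s)|%:R
    / #|parabolic e s : unitri e r * parabolicL e s|%g%:R =
  #|orbit (config_action V r) H @: [set c in configs e | #|vsupp c| == s]|%:R
  :> rat.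
Proof.
move=> sr; rewrite mul_unitri_parabolicL //.
have -> : #|doubleCosets H (autV V) (parabolicL e s)| =
    (#|parabolic e s : unitri e s|%g *
     #|dcosets (parabolicL_group basis_e s) H (echelon e s)|)%N.
  apply: (@card_dcosets_split _ (autV_group V) (parabolic_group basis_e s)
    (unitri_group basis_e s) (parabolicL_group basis_e s) H (echelon e s)).
  - by apply/subsetP => g /(parabolicP basis_e)[].
  - exact: unitri_sub_parabolic.
  - apply/subsetP => g /(parabolicLP basis_e)[autg gE]; apply/unitriP; split=> // j js.
    by rewrite gE //; apply: monic_e.
  - exact: parabolicL_norm.
  - by apply/subsetP => g /echelonP[].
  - by move=> m b; apply: echelon_mull.
  - by move=> b h be hH; apply: echelon_mulr => //; apply: (subsetP HU).
  - by move=> g; apply: echelon_exists.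
  by move=> p b; apply: echelon_rigid.
rewrite card_dcosets_echelon // natrM mulrC mulKf //.
rewrite Num.Theory.pnatr_eq0 -lt0n.
exact: (indexg_gt0 (parabolic_group basis_e s) (unitri_group basis_e s)).
Qed.

End FlagCase.

(** * Conjugating a unipotent group into the unitriangular one *)

Section FrobeniusDifference.
Variables (E : zmodType) (p : nat).
Hypotheses (p_prime : prime p) (p_char : forall x : E, x *+ p = 0).

Lemma iter_binomial (h : E -> E) : {morph h : x y / x + y} -> forall n v,
  iter n h v = \sum_(k < n.+1) iter k (fun x => h x - x) v *+ 'C(n, k).
Proof.
move=> hD; have h0 : h 0 = 0.
  by apply: (@addrI _ (h 0)); rewrite addr0 -hD addr0.
have hMn x n : h (x *+ n) = h x *+ n.
  by elim: n => [|n IH]; rewrite ?mulr0n // !mulrS hD IH.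
set d := fun x => h x - x; elim=> [|n IH] v.
  by rewrite big_ord1 /= bin0.
rewrite iterS IH (big_morph h hD h0).
transitivity (\sum_(k < n.+1) iter k.+1 d v *+ 'C(n, k) +
              \sum_(k < n.+1) iter k d v *+ 'C(n, k)).
  by rewrite -big_split; apply: eq_bigr => k _; rewrite hMn /= -mulrnDl {1}/d subrK.
rewrite [X in _ + X]big_ord_recl [RHS]big_ord_recl !bin0 /= addrCA; congr (_ + _).
under [RHS]eq_bigr => k _ do rewrite binS mulrnDr.
rewrite big_split addrC; congr (_ + _).
by rewrite [RHS]big_ord_recr /= bin_small // mulr0n addr0.
Qed.

Lemma iter_prime (h : E -> E) : {morph h : x y / x + y} -> forall v,
  iter p h v = v + iter p (fun x => h x - x) v.
Proof.
move=> hD v; rewrite (iter_binomial hD); case: p p_prime p_char => // q q_prime q_char.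
rewrite big_ord_recr big_ord_recl /= bin0 binn big1 ?addr0 // => k _.
have /dvdnP[c ->] : (q.+1 %| 'C(q.+1, bump 0 k))%N.
  by apply: prime_dvd_bin => //; rewrite /bump add1n /= ltnS ltn_ord.
by rewrite mulrnA q_char.
Qed.

(** In the ring of endomorphisms this reads [h ^ (p ^ N) = 1 + (h - 1) ^ (p ^ N)]. *)
Lemma iter_prime_exp (h : E -> E) N : {morph h : x y / x + y} -> forall v,
  iter (p ^ N) h v = v + iter (p ^ N) (fun x => h x - x) v.
Proof.
move=> hD; set d := fun x => h x - x.
have iterD n : {morph iter n h : x y / x + y}.
  by elim: n => // n IH x y; rewrite !iterS IH hD.
elim: N => [|N IH] v; first by rewrite expn0 /= addrC subrK.
rewrite expnS iterM iter_prime // iterM; congr (_ + _).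
by apply: eq_iter => x; rewrite IH addrAC subrr add0r.
Qed.
End FrobeniusDifference.

Section Unipotent.
Variables (F : finFieldType) (V : vectType F).
Local Notation fV := (finvect_type V).
Implicit Types (H : {group {perm fV}}).

(** If [(h - 1) ^ (p ^ N)] vanishes then so does [h ^ (p ^ N) - 1], and conversely.  In one
direction [h] is an element of prime order given by Cauchy's theorem; in the other,
[p ^ N] is the order of the group. *)
Lemma unipotent_pgroup p H : prime p -> (forall x : fV, x *+ p = 0) ->
  unipotent H <-> H \subset autV V /\ (p.-group H)%g.
Proof.
move=> pp pchar; split=> [[HA uni]|[HA pH]]; split=> //.
  apply/pgroupP => q qp /(Cauchy qp)[h hH hq].
  have hD : {morph (h : fV -> fV) : x y / x + y}.
    by move=> x y; apply: (autD x y (subsetP HA h hH)).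
  have [N uniN] := uni h hH.
  have : (h ^+ (p ^ N) == 1)%g.
    apply/eqP/permP => v; rewrite permX perm1 (iter_prime_exp pp pchar N hD).
    (* [N < p ^ N], so the power [p ^ N] of [h - 1] vanishes *)
    rewrite -(subnK (ltnW (ltn_expl N (prime_gt1 pp)))) iterD uniN.
    have -> k : iter k (fun x => h x - x) 0 = 0 :> fV.
      by elim: k => //= k ->; rewrite -[h _]/(h (0 : V)) (aut0 (subsetP HA h hH)) subr0.
    by rewrite addr0.
  rewrite -order_dvdn hq (Euclid_dvdX _ _ qp) => /andP[].
  by rewrite dvdn_prime2 // inE.
move=> h hH; have [k card_H] := p_natP pH; exists (p ^ k)%N => v.
have hD : {morph (h : fV -> fV) : x y / x + y}.
  by move=> x y; apply: (autD x y (subsetP HA h hH)).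
apply: (@addrI _ v); rewrite -(iter_prime_exp pp pchar k hD) addr0 -permX -card_H.
by rewrite expg_cardG // perm1.
Qed.

(** Maximal unipotent subgroups are Sylow subgroups. *)
Lemma unipotent_conj_sub (U H : {group {perm fV}}) :
  max_unipotent U -> unipotent H -> exists2 x, x \in autV V & (H :^ x \subset U)%g.
Proof.
move=> [uniU maxU] uniH; have [p pp pcharF] := finPcharP F.
have pchar (x : fV) : x *+ p = 0.
  by rewrite -scaler_nat (pcharf0 pcharF) scale0r.
have pg H' := unipotent_pgroup H' pp pchar.
have [HA pH] := (pg H).1 uniH.
apply: (Sylow_Jsub (p := p) (G := autV_group V)) => //.
rewrite -max_pgroup_Sylow; apply/maxgroupP; split.
  by apply/andP; exact: ((pg U).1 uniU).
by move=> U' /andP[U'A pU'] UU'; rewrite (maxU U') //; apply/pg.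
Qed.
End Unipotent.

Section Conjugation.
Variables (F : finFieldType) (V : vectType F).
Local Notation fV := (finvect_type V).
Implicit Types (H : {group {perm fV}}) (x : {perm fV}).

Lemma card_doubleCosetsJ H x (L : {set {perm fV}}) : x \in autV V ->
  #|doubleCosets (H :^ x)%g (autV V) L| = #|doubleCosets H (autV V) L|.
Proof.
move=> xA; rewrite -[RHS](card_imset _ (can_inj (rcosetK x))).
apply: eq_card => D; apply/imsetP/imsetP => [[g gA ->]|[_ /imsetP[g gA ->] ->]].
  exists (L * [set (g * x^-1)%g] * H)%g.
    by apply/imsetP; exists (g * x^-1)%g; rewrite // groupM ?groupV.
  by rewrite -mulg_set1 conjsgE !mulgA.
exists (g * x)%g; first by rewrite groupM.
rewrite -mulg_set1 conjsgE !mulgA; congr (_ * _ * _)%g.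
by rewrite -!mulgA mulg_set1 mulgV mulg1.
Qed.

Lemma RVdeg_fracAut n x (autx : x \in autV V) y :
  RVdeg n y -> RVdeg n (fracAut autx y).
Proof.
move=> [m [c [v [v0 ->]]]]; exists m, c, (fun i j => x (v i j) : V).
split=> [i j|].
  apply: contraNneq (v0 i j) => xv0; apply/eqP/(@perm_inj _ x).
  by rewrite xv0 aut0.
rewrite linear_sum; apply: eq_bigr => i _ /=; rewrite linearZ rmorph_prod /=.
by congr (_ *: _); apply: eq_bigr => j _; apply: fracAut_recip.
Qed.

Lemma fracAutK x (autx : x \in autV V) (autVx : (x^-1)%g \in autV V) :
  cancel (fracAut autx) (fracAut autVx).
Proof.
move=> y; have aut1 : (x * x^-1)%g \in autV V by rewrite mulgV group1.
rewrite -(fracAut_comp autx autVx aut1); move: aut1; rewrite mulgV => aut1.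
exact: fracAut1.
Qed.

Lemma invRV_fracAut n x (autx : x \in autV V) H y : H \subset autV V ->
  @invRV F V H n y -> @invRV F V (H :^ x)%g n (fracAut autx y).
Proof.
move=> HA [ry inv]; split=> [|_ /imsetP[h hH ->]]; first exact: RVdeg_fracAut.
have auth := subsetP HA h hH; have autVx := groupVr autx.
have autJ : (h ^ x)%g \in autV V by rewrite groupJ.
have autVxh : (x^-1 * h)%g \in autV V by rewrite groupM.
have autVxhx : (x^-1 * h * x)%g \in autV V by rewrite groupM.
rewrite conjgE mulgA -[LHS]/(fracAut autVxhx _).
rewrite (fracAut_comp autVxh autx) (fracAut_comp autVx auth) fracAutK.
by rewrite -[fracAut auth y]/(fracMap _ _) inv.
Qed.

Lemma hasDim_invRVJ n x H d : x \in autV V -> H \subset autV V ->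
  hasDim (@invRV F V (H :^ x)%g n) d -> hasDim (@invRV F V H n) d.
Proof.
move=> autx HA; have autVx := groupVr autx.
have fK := fracAutK autVx; rewrite invgK in fK.
apply: (hasDim_iso (fK autx) (fracAutK autx autVx)) => y; split.
  exact: invRV_fracAut.
move=> /(invRV_fracAut (H := (H :^ x)%G) autVx); rewrite fracAutK /= conjsgK.
by apply; rewrite -(conjSg _ _ x^-1%g) conjsgK (normsP (normG (autV_group V))) .
Qed.
End Conjugation.

(** * The dimension formula *)

Theorem theorem4p1 (F : finFieldType) (V : vectType F) (r : nat)
    (r_gt0 : (0 < r)%N) (dimV : \dim {:V} = r)
    (U : {group {perm (finvect_type V)}}) (maxU : max_unipotent U)
    (e : r.-tuple V) (basis_e : basis_of {:V} e)
    (U_e : U = unitriangular e :> {set {perm (finvect_type V)}})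
    (H : {group {perm (finvect_type V)}}) (unipH : unipotent H) (n : nat) :
  exists2 d : nat, hasDim (@invRV F V H n) d &
    d%:R = \sum_(1 <= s < r.+1)
      #|doubleCosets H (autV V) (parabolicL e s)|%:R
        / #|parabolic e s : U * parabolicL e s|%g%:R
        * binz (n%:Z - 1) (s - 1) :> rat.
Proof.
have [x xA HxU] := unipotent_conj_sub maxU unipH.
rewrite U_e unitriangularE // in HxU *.
pose Hx := (H :^ x)%G.
exists #|orbit (index_action V r n) Hx @: graded_monomials e n|.
  by apply: (hasDim_invRVJ xA unipH.1); exact: (hasDim_invRV basis_e HxU).
rewrite (card_orbits_graded basis_e HxU) //.
apply: eq_big_nat => s /andP[_]; rewrite ltnS => sr.
by rewrite -(orbit_configs_dcosets basis_e HxU sr) card_doubleCosetsJ.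
Qed.
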